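(* Let $\mathbf z^*$ be a strictly minimal multiple point of degree $n+1$ of $\mathcal V$. Let $R(s,\widehat{\mathbf z},\varepsilon)$ be the sum of the residues of the function $g:z\mapsto z^{-s-1}F(\widehat{\mathbf z},z)$ inside the ball $|z-z^*_{d+1}|<\varepsilon$. Define $h_{s,\widehat{\mathbf z}}(y)=y^{s+n}\phi(\widehat{\mathbf z},1/y)$. Then for sufficiently small $\varepsilon>0$ there is $\delta>0$ such that for $|\widehat{\mathbf z}-\widehat{\mathbf z^*}|<\delta$, $$R(s,\widehat{\mathbf z},\varepsilon)=\int_{\Delta}h^{(n)}_{s,\widehat{\mathbf z}}\big(\boldsymbol\alpha\mathbf v(\widehat{\mathbf z})\big)\,d\mu(\boldsymbol\alpha).$$
   Context: Vectors in $\mathbb C^{d+1}$ are written $\mathbf z=(\widehat{\mathbf z},z)$ with $\widehat{\mathbf z}=(z_1,\dots,z_d)$ and $z=z_{d+1}$. $G,H$ are analytic in some open polydisk about $\mathbf 0$, $F=G/H$ is analytic near $\mathbf 0$, and $\mathcal V=\{H=0\}$. $\mathcal D$ is the open domain of convergence of the power series of $F$ at $\mathbf 0$; $\mathbf z^*\in\mathcal V$ is minimal if $\mathbf z^*\in\partial\mathcal D$ and all its coordinates are nonzero, and strictly minimal if also $\mathcal V$ meets the closed polydisk $\{|z_j|\le|z^*_j|\ \forall j\}$ only at $\mathbf z^*$. $\mathbf z^*$ is a multiple point of degree $n+1$ if there are analytic functions $v_0,\dots,v_n$ (near $\widehat{\mathbf z^*}$, not necessarily distinct) and $\phi$ (near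 $\mathbf z^*$) with $$F(\mathbf z)=\frac{\phi(\mathbf z)}{\prod_{j=0}^n(1-zv_j(\widehat{\mathbf z}))}$$ near $\mathbf z^*$, such that $z^*_{d+1}v_j(\widehat{\mathbf z^*})=1$ for all $j$; each $\partial v_j/\partial z_k(\widehat{\mathbf z^*})\ne0$; and, near $\mathbf z^*$, $zv_j(\widehat{\mathbf z})=1$ for some $j$ if and only if $\mathbf z\in\mathcal V$. $s$ denotes the nonnegative integer $r_{d+1}$. $\Delta=\{\boldsymbol\alpha\in\mathbb R^{n+1}:\sum_{j=0}^n\alpha_j=1,\ \alpha_j\ge0\}$, $\mu$ is the normalized volume measure on $\Delta$ (total mass $1$), $\boldsymbol\alpha\mathbf v=\sum_{j=0}^n\alpha_jv_j$, and $h^{(n)}$ is the $n$th derivative.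
   Formalization: The printed formula misses the constant -1/n!: the formal theorem states R(s,ẑ,ε) = -(1/n!) ∫_Δ h^(n)(αv(ẑ)) dμ with μ of total mass 1; the printed version already fails for n=0, H=1-z1-z2, G=1, z*=(1/2,1/2), where R=-h(v). *)

(* Defs.v *)
From HB Require Import structures.
From mathcomp Require Import all_boot all_order all_algebra.
From mathcomp Require Import complex.
From mathcomp Require Import all_classical all_reals all_analysis.
From mathcomp Require Import measurable_realfun.

Set Implicit Arguments.
Unset Strict Implicit.
Unset Printing Implicit Defensive.

Import Order.TTheory GRing.Theory Num.Theory.
Import numFieldNormedType.Exports.

Local Open Scope classical_set_scope.
Local Open Scope ring_scope.
Local Open Scope complex_scope.

(* [R[i]] is normed over itself, with the topology given by its modulus. As
   everywhere in MathComp, the modulus [`|z|] is an element of [R[i]], so real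
   bounds are injected with [%:C]. *)
#[export, non_forgetful_inheritance]
HB.instance Definition _ (R : realType) :=
  PseudoPointedMetric.copy R[i] R[i]^o.
#[export, non_forgetful_inheritance]
HB.instance Definition _ (R : realType) := GRing.ComAlgebra.copy R[i] R[i]^o.
#[export, non_forgetful_inheritance]
HB.instance Definition _ (R : realType) := Vector.copy R[i] R[i]^o.
#[export, non_forgetful_inheritance]
HB.instance Definition _ (R : realType) := NormedModule.copy R[i] R[i]^o.

Section PowerSeries.
Context {R : realType} {m : nat}.
Implicit Types (c : {ffun 'I_m -> nat} -> R[i]) (z : 'rV[R[i]]_m).

Definition pterm c z (r : {ffun 'I_m -> nat}) : R[i] :=
  c r * \prod_(k < m) z 0 k ^+ r k.

Definition abs_convergent c z : Prop :=
  summable setT (fun r => (complex.Re `|pterm c z r|)%:E).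

(* For an absolutely convergent series, the sum is the limit of the partial
   sums over the boxes {0, ..., N-1}^m. *)
Definition box_sum c z (N : nat) : R[i] :=
  \sum_(r : {ffun 'I_m -> 'I_N}) pterm c z [ffun k => nat_of_ord (r k)].

Definition psum_to c z (l : R[i]) : Prop :=
  abs_convergent c z /\ box_sum c z @ \oo --> l.

Definition analytic_at (f : 'rV[R[i]]_m -> R[i]) (p : 'rV[R[i]]_m) : Prop :=
  exists c, \forall z \near p, psum_to c (z - p) (f z).

Definition convergence_domain c : set 'rV[R[i]]_m := [set z | abs_convergent c z]^°.

Definition polydisk (rho : 'I_m -> R) : set 'rV[R[i]]_m :=
  [set z | forall k, `|z 0 k| < (rho k)%:C].

Definition closed_polydisk_through (p : 'rV[R[i]]_m) : set 'rV[R[i]]_m :=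
  [set z | forall k, `|z 0 k| <= `|p 0 k|].

End PowerSeries.

Section Residue.
Context {R : realType}.
Implicit Types (g : R[i] -> R[i]) (a : R[i]).

(* [g] is meromorphic at [a], with residue [w]: near [a] and away from [a] it is
   the sum of a finite principal part and of a convergent power series. *)
Definition is_residue g a (w : R[i]) : Prop :=
  exists (N : nat) (b c : nat -> R[i]), b 0%N = w /\
    \forall z \near a^',
      series (fun k => c k * (z - a) ^+ k) @ \oo -->
        g z - \sum_(k < N.+1) b k * (z - a) ^- k.+1.

(* A residue is unique when it exists; 0 where [g] is not meromorphic. *)
Definition residue g a : R[i] := xget 0 [set w | is_residue g a w].

(* The sum has only finitely many nonzero terms when [g] is meromorphic in a
   neighborhood of the closed disk. *)
Definition residue_sum g (a : R[i]) (e : R) : R[i] :=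
  \sum_(z \in [set z | `|z - a| < e%:C]) residue g z.

End Residue.

Section Lebesgue.
Context {R : realType}.
Local Notation TR := (measurableTypeR R).

Definition tuple_cons n (p : TR * n.-tuple TR) : n.+1.-tuple TR :=
  [tuple of p.1 :: p.2].

Definition tuple_uncons n (t : n.+1.-tuple TR) : TR * n.-tuple TR :=
  (tnth t ord0, [tuple of behead t]).

Lemma tuple_consK n : cancel (@tuple_cons n) (@tuple_uncons n).
Proof. by move=> [x t]; congr pair; apply/val_inj. Qed.

Lemma tuple_unconsK n : cancel (@tuple_uncons n) (@tuple_cons n).
Proof. by move=> t; rewrite /tuple_cons/= [RHS]tuple_eta. Qed.

Lemma measurable_tuple_cons n : measurable_fun setT (@tuple_cons n).
Proof. exact: measurable_cons. Qed.

Lemma measurable_tuple_uncons n : measurable_fun setT (@tuple_uncons n).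
Proof.
apply: measurable_fun_pair; first exact: measurable_tnth.
exact: measurable_behead.
Qed.

Section step.
Variables (n : nat) (mu : {sigma_finite_measure set (n.-tuple TR) -> \bar R}).

Definition lebesgue_step : set (n.+1.-tuple TR) -> \bar R :=
  pushforward (lebesgue_measure \x mu)%E (@tuple_cons n).

Let step_preimage A : measurable A -> measurable (@tuple_cons n @^-1` A).
Proof.
by move=> mA; rewrite -[X in measurable X]setTI; exact: measurable_tuple_cons.
Qed.

Let step0 : lebesgue_step set0 = 0%E.
Proof. by rewrite /lebesgue_step /pushforward preimage_set0 measure0. Qed.

Let step_ge0 A : (0 <= lebesgue_step A)%E.
Proof. by apply: integral_ge0 => x _; exact: measure_ge0. Qed.

Let step_sigma_additive : semi_sigma_additive lebesgue_step.
Proof.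
move=> F mF tF mUF; rewrite /lebesgue_step /pushforward preimage_bigcup.
apply: measure_semi_sigma_additive.
- by move=> k; exact: step_preimage.
- apply/trivIsetP => i j _ _ ij; rewrite -preimage_setI.
  by move/trivIsetP : tF => /(_ _ _ _ _ ij) ->//; rewrite preimage_set0.
- by rewrite -preimage_bigcup; exact: step_preimage.
Qed.

HB.instance Definition _ := isMeasure.Build _ _ _ lebesgue_step
  step0 step_ge0 step_sigma_additive.

Let step_sigma_finite : sigma_finite setT lebesgue_step.
Proof.
have /sigma_finiteP[F [TF ndF Foo]] := sigma_finiteT (@lebesgue_measure R).
have /sigma_finiteP[G [TG ndG Goo]] := sigma_finiteT mu.
exists (fun k => @tuple_uncons n @^-1` (F k `*` G k)).
  apply/seteqP; split=> // t _.
  have [i _ Fi] : (\bigcup_i F i) (tuple_uncons t).1 by rewrite -TF.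
  have [j _ Gj] : (\bigcup_j G j) (tuple_uncons t).2 by rewrite -TG.
  exists (maxn i j) => //; split.
    by move: Fi; exact/subsetPset/ndF/leq_maxl.
  by move: Gj; exact/subsetPset/ndG/leq_maxr.
move=> k; have [mFk Fk] := Foo k; have [mGk Gk] := Goo k; split.
  rewrite -[X in measurable X]setTI; apply: measurable_tuple_uncons => //.
  exact: measurableX.
rewrite /lebesgue_step /pushforward -comp_preimage.
rewrite (_ : _ \o _ = id) ?preimage_id; last first.
  by apply/funext => p; exact: tuple_consK.
by rewrite product_measure1E// lte_mul_pinfty// ge0_fin_numE.
Qed.

HB.instance Definition _ := Measure_isSigmaFinite.Build _ _ _ lebesgue_step
  step_sigma_finite.

End step.

(* Lebesgue measure on R^n, as the n-fold product of Lebesgue measure on R. *)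
Fixpoint lebesgue_tuple (n : nat) :
    {sigma_finite_measure set (n.-tuple TR) -> \bar R} :=
  if n is n'.+1 then lebesgue_step (lebesgue_tuple n') else \d_[tuple].

End Lebesgue.

Section Simplex.
Context {R : realType} {n : nat}.
Local Notation TR := (measurableTypeR R).

Definition simplex : set (n.+1.-tuple TR) :=
  [set alpha | (forall j, 0 <= (tnth alpha j : R)) /\
               \sum_(j < n.+1) (tnth alpha j : R) = 1].

(* Affine parametrization of the hyperplane spanned by the simplex. It
   multiplies n-dimensional volumes by a constant, which normalization
   removes. *)
Definition simplex_chart (t : n.-tuple TR) : n.+1.-tuple TR :=
  [tuple of (1 - \sum_(i < n) (tnth t i : R) : TR) :: t].

Lemma measurable_simplex_chart : measurable_fun setT simplex_chart.
Proof.
apply: measurable_cons; last exact: measurable_id.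
apply: measurable_funB => //; apply: measurable_sum => i.
exact: measurable_tnth.
Qed.

Lemma measurable_simplex : measurable simplex.
Proof.
rewrite /simplex (_ : [set _ | _] =
  (\bigcap_(j in [set: 'I_n.+1]) ((fun a => tnth a j : R) @^-1` `[0, +oo[)) `&`
  (fun a => \sum_(j < n.+1) (tnth a j : R)) @^-1` [set 1]); last first.
  apply/seteqP; split => a /= [a0 a1]; split => // j.
    by move=> _ /=; rewrite in_itv/= a0.
  by have := a0 j Logic.I; rewrite /= in_itv/= andbT.
apply: measurableI.
  apply: fin_bigcap_measurable => // j _; rewrite -[X in measurable X]setTI.
  exact: measurable_tnth.
rewrite -[X in measurable X]setTI.
have msum : measurable_fun setT (fun a : n.+1.-tuple TR =>
    \sum_(j < n.+1) (tnth a j : R)).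
  by apply: measurable_sum => j; exact: measurable_tnth.
exact: msum.
Qed.

Definition simplex_volume : set (n.+1.-tuple TR) -> \bar R :=
  fun A => lebesgue_tuple n (simplex_chart @^-1` (A `&` simplex)).

Let chart_preimage A :
  measurable A -> measurable (simplex_chart @^-1` (A `&` simplex)).
Proof.
move=> mA; rewrite -[X in measurable X]setTI.
apply: measurable_simplex_chart => //.
by apply: measurableI => //; exact: measurable_simplex.
Qed.

Let volume0 : simplex_volume set0 = 0%E.
Proof. by rewrite /simplex_volume set0I preimage_set0 measure0. Qed.

Let volume_ge0 A : (0 <= simplex_volume A)%E.
Proof. exact: measure_ge0. Qed.

Let volume_sigma_additive : semi_sigma_additive simplex_volume.
Proof.
move=> F mF tF mUF; rewrite /simplex_volume setI_bigcupl preimage_bigcup.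
apply: measure_semi_sigma_additive.
- by move=> k; exact: chart_preimage.
- apply/trivIsetP => i j _ _ ij; rewrite -preimage_setI setIACA.
  move/trivIsetP : tF => /(_ _ _ _ _ ij) ->//.
  by rewrite set0I preimage_set0.
- by rewrite -preimage_bigcup -setI_bigcupl; exact: chart_preimage.
Qed.

HB.instance Definition _ := isMeasure.Build _ _ _ simplex_volume
  volume0 volume_ge0 volume_sigma_additive.

(* The Dirac mass is the default value that [mnormalize] requires for a measure
   that is null or infinite. *)
Definition simplex_measure : probability (n.+1.-tuple TR) R :=
  mnormalize simplex_volume (\d_(simplex_chart [tuple (0 : TR) | _ < n])).

End Simplex.

Definition complex_integral (R : realType) d (T : measurableType d)
    (mu : {measure set T -> \bar R}) (D : set T) (f : T -> R[i]) : R[i] :=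
  (\int[mu]_(x in D) complex.Re (f x)) +i* (\int[mu]_(x in D) complex.Im (f x)).

Section MultiplePoint.
Context {R : realType} {d : nat}.
Local Notation Cd := 'rV[R[i]]_d.
Local Notation Cd1 := 'rV[R[i]]_(d + 1).
Implicit Types (z : Cd1) (zh : Cd) (V : set Cd1).

Definition zhat z : Cd := lsubmx z.
Definition zlast z : R[i] := rsubmx z 0 0.
Definition zjoin zh (w : R[i]) : Cd1 := row_mx zh w%:M.

(* The singular variety, inside the polydisk on which [G] and [H] live. *)
Definition variety (H : Cd1 -> R[i]) (rho : 'I_(d + 1) -> R) : set Cd1 :=
  polydisk rho `&` [set z | H z = 0].

(* [F = G / H] as a meromorphic function on the polydisk: its values on the
   zero set of [H] are unconstrained, so that removable singularities may be
   filled in. *)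
Definition is_quotient (F G H : Cd1 -> R[i]) (rho : 'I_(d + 1) -> R) : Prop :=
  forall z, polydisk rho z -> H z != 0 -> F z = G z / H z.

(* [a] is the power series at 0 of [F], whose open domain of convergence
   [convergence_domain a] has boundary [closure _ `\` _]. *)
Definition minimal V (a : {ffun 'I_(d + 1) -> nat} -> R[i]) z : Prop :=
  [/\ V z,
      (closure (convergence_domain a) `\` convergence_domain a) z &
      forall k, z 0 k != 0].

Definition strictly_minimal V a z : Prop :=
  minimal V a z /\ V `&` closed_polydisk_through z = [set z].

Definition multiple_point (n : nat) (F : Cd1 -> R[i]) V
    (v : 'I_n.+1 -> Cd -> R[i]) (phi : Cd1 -> R[i]) (zs : Cd1) : Prop :=
  [/\ (forall j, analytic_at (v j) (zhat zs)) /\ analytic_at phi zs,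
      \forall z \near zs, ~ V z ->
        F z = phi z / \prod_(j < n.+1) (1 - zlast z * v j (zhat z)),
      forall j, zlast zs * v j (zhat zs) = 1,
      forall j (k : 'I_d), 'D_(delta_mx 0 k) (v j) (zhat zs) != 0 &
      \forall z \near zs, (exists j, zlast z * v j (zhat z) = 1) <-> V z].

Definition slice (F : Cd1 -> R[i]) (s : nat) zh (w : R[i]) : R[i] :=
  w ^- s.+1 * F (zjoin zh w).

(* Substituting [w = 1/y] gives [slice F s zh w dw = - hfun y / \prod_j (y - v_j)
   dy]; the residues in [w] therefore add up to minus the divided difference of
   [hfun] at the [v_j]. By the Hermite-Genocchi formula that divided difference
   is [1/n!] times the mean of the n-th derivative over the simplex, [1/n!] being
   the mass of the simplex in affine coordinates. *)
Definition hfun (n : nat) (phi : Cd1 -> R[i]) (s : nat) zh (y : R[i]) : R[i] :=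
  y ^+ (s + n) * phi (zjoin zh y^-1).

End MultiplePoint.

(* Main.v *)
Require Import Defs.
From HB Require Import structures.
From mathcomp Require Import all_boot all_order all_algebra.
From mathcomp Require Import complex.
From mathcomp Require Import all_classical all_reals all_analysis.
From mathcomp Require Import measurable_realfun ring lra zify.
Import Order.TTheory GRing.Theory Num.Theory.
Import numFieldNormedType.Exports.
Local Open Scope classical_set_scope.
Local Open Scope ring_scope.
Local Open Scope complex_scope.

(** Put [y = 1 / z]. Near the multiple point, the integrand [z ^- s.+1 * F] times
    [dz] becomes [- h y / \prod_j (y - v_j) * dy], where [h] is the function
    [hfun], analytic near the common value [y0] of the [v_j] at the point. So its
    residues in a small disk add up to minus the divided difference
    [h[v_0, ..., v_n]], and the Hermite-Genocchi formula writes that divided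
    difference as an integral of the [n]-th derivative of [h] over the simplex.

    No contour integral is used: all functions are handled through their power
    series, on disks whose radius does not depend on the parameter [zh]
    ([slice_expands] for [phi], [inversion_expansion] for the substitution
    [y = 1 / z]). Both sides of the formula are then reduced to the same series
    [\sum_m c_m * (y ^+ m)[v_0, ..., v_n]], where the [c_m] are the coefficients
    of [h], which never requires the [v_j] to be distinct.

    - For the residues ([has_residue_sum_divdiff]), Newton's interpolation writes
      [h] as [h v_0 + (y - v_0) * h1] and iterates. The quotients [h1] are again
      power series with the same radius ([difference_quotient]). A polar term
      with at least two factors has residue sum 0, a single factor gives -1, and
      the final quotient is regular.

    - For the integral ([mean_derive1n]), the [n]-th derivative is expanded into
      powers of [y - y0]. A convex combination of the [v_j] turns these powers
      into powers of a linear form on the simplex, whose means follow from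
      Dirichlet's integrals of monomials ([integral_dirichlet], [mean_pow]):
      they are complete homogeneous polynomials, that is, divided differences of
      powers. Dominated convergence sums up.

    Exchanges of summation rest on one principle, [superposition]: a normally
    convergent sum of power series may be rearranged by degree, also after every
    functional that is bounded for the norm. *)

Set Implicit Arguments.
Unset Strict Implicit.
Unset Printing Implicit Defensive.

Local Notation nc := (@Normc.normc _).

(** * Real moduli and limits of complex sequences *)

Section Modulus.
Variable R : realType.
Local Notation C := R[i].
Implicit Types (x y l m : C) (u : nat -> C).

Lemma normE x : `|x| = (nc x)%:C. Proof. by case: x. Qed.
Lemma nc_Re x : nc x = complex.Re `|x|. Proof. by case: x. Qed.
Lemma nc_ge0 x : 0 <= nc x. Proof. by case: x => a b; exact: sqrtr_ge0. Qed.
Lemma nc0 : nc (0 : C) = 0. Proof. exact: Normc.normc0. Qed.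
Lemma nc1 : nc (1 : C) = 1. Proof. exact: Normc.normc1. Qed.
Lemma ncM x y : nc (x * y) = nc x * nc y. Proof. exact: Normc.normcM. Qed.
Lemma ncV x : nc x^-1 = (nc x)^-1. Proof. exact: Normc.normcV. Qed.
Lemma ncN x : nc (- x) = nc x. Proof. exact: normcN. Qed.
Lemma ncD x y : nc (x + y) <= nc x + nc y. Proof. exact: le_normcD. Qed.
Lemma ncB x y : nc (x - y) <= nc x + nc y.
Proof. by rewrite -(ncN y); exact: ncD. Qed.
Lemma ncBC x y : nc (x - y) = nc (y - x). Proof. by rewrite -ncN opprB. Qed.
Lemma ncX x n : nc (x ^+ n) = nc x ^+ n.
Proof. by elim: n => [|n ih]; rewrite ?expr0 ?nc1// !exprS ncM ih. Qed.
Lemma nc_eq0 x : (nc x == 0) = (x == 0).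
Proof. by apply/eqP/eqP => [/Normc.eq0_normc//|->]; rewrite nc0. Qed.
Lemma nc_gt0 x : (0 < nc x) = (x != 0).
Proof. by rewrite lt_def nc_ge0 andbT nc_eq0. Qed.
Lemma nc_real (a : R) : nc a%:C = `|a|.
Proof. by rewrite /= expr0n addr0 sqrtr_sqr. Qed.
Lemma nc_nat n : nc (n%:R : C) = n%:R.
Proof. by rewrite -(rmorph_nat (real_complex R)) nc_real ger0_norm. Qed.
Lemma nc_sum (I : Type) (s : seq I) (P : pred I) (f : I -> C) :
  nc (\sum_(i <- s | P i) f i) <= \sum_(i <- s | P i) nc (f i).
Proof.
elim/big_rec2 : _ => [|i y x _ h]; first by rewrite nc0.
by apply: le_trans (ncD _ _) _; rewrite lerD2l.
Qed.
Lemma nc_prod (I : Type) (s : seq I) (P : pred I) (f : I -> C) :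
  nc (\prod_(i <- s | P i) f i) = \prod_(i <- s | P i) nc (f i).
Proof. by elim/big_rec2 : _ => [|i y x _ h]; rewrite ?nc1// ncM h. Qed.
Lemma Re_le_nc x : `|complex.Re x| <= nc x.
Proof.
by case: x => a b; rewrite /= -sqrtr_sqr ler_wsqrtr// lerDl sqr_ge0.
Qed.
Lemma Im_le_nc x : `|complex.Im x| <= nc x.
Proof.
by case: x => a b; rewrite /= -sqrtr_sqr ler_wsqrtr// lerDr sqr_ge0.
Qed.
Lemma nc_le_ReIm x : nc x <= `|complex.Re x| + `|complex.Im x|.
Proof.
have -> : nc x = nc ((complex.Re x)%:C + 'i * (complex.Im x)%:C) by rewrite -complexE.
by apply: le_trans (ncD _ _) _; rewrite ncM !nc_real /= expr0n expr1n add0r sqrtr1 mul1r.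
Qed.

Lemma ltc_nc x (e : R) : (`|x| < e%:C) = (nc x < e).
Proof. by rewrite normE ltcR. Qed.

(** Limits in the complex numbers are reached through their real moduli, so that
    all estimates below are inequalities between real numbers. *)
Lemma cvgcP u l : u @ \oo --> l <->
  forall e, 0 < e -> exists N, forall n, (N <= n)%N -> nc (u n - l) < e.
Proof.
split=> [/cvgrPdist_lt ul e e0|h].
  have /= [N _ h] := ul e%:C (etrans (ltcR _ _) e0).
  by exists N => n Nn; have := h n Nn; rewrite /= ltc_nc ncBC.
apply/cvgrPdist_lt => e e0.
have er : e = (complex.Re e)%:C by rewrite RRe_real// ger0_real// ltW.
have [|N hN] := h (complex.Re e); first by rewrite -ltcR -er.
by exists N => // n Nn /=; rewrite er ltc_nc ncBC hN.
Qed.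

Lemma cvgrP (u : nat -> R) (l : R) : u @ \oo --> l <->
  forall e, 0 < e -> exists N, forall n, (N <= n)%N -> `|u n - l| < e.
Proof.
split=> [/cvgrPdist_lt ul e e0|h].
  have /= [N _ h] := ul e e0.
  by exists N => n Nn; have := h n Nn; rewrite /= distrC.
apply/cvgrPdist_lt => e e0; have [N hN] := h e e0.
by exists N => // n Nn /=; rewrite distrC hN.
Qed.

Lemma cvgc_unique u l m : u @ \oo --> l -> u @ \oo --> m -> l = m.
Proof. by move=> ul um; apply: (cvg_unique _ ul um); exact: norm_hausdorff. Qed.

Lemma cvgc_0 u l (d : nat -> R) : d @ \oo --> (0 : R) ->
  (forall n, nc (u n - l) <= d n) -> u @ \oo --> l.
Proof.
move=> /cvgrP d0 h; apply/cvgcP => e e0; have [N hN] := d0 e e0.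
exists N => n Nn; apply: le_lt_trans (h n) _.
by apply: le_lt_trans (hN n Nn); rewrite subr0 ler_norm.
Qed.

Lemma cvgc_ncB u l : u @ \oo --> l -> (fun n => nc (u n - l)) @ \oo --> (0 : R).
Proof.
move=> /cvgcP ul; apply/cvgrP => e e0; have [N hN] := ul e e0.
by exists N => n Nn; rewrite subr0 ger0_norm ?nc_ge0 ?hN.
Qed.

Lemma cvgc_nc u l : u @ \oo --> l -> (fun n => nc (u n)) @ \oo --> nc l.
Proof.
move=> /cvgcP ul; apply/cvgrP => e e0; have [N hN] := ul e e0.
exists N => n Nn; apply: le_lt_trans (hN n Nn).
have h1 := ncD (u n - l) l; have h2 := ncB (u n) (u n - l).
rewrite subrK in h1; rewrite opprB addrC subrK in h2.
by rewrite ler_norml; apply/andP; split; lra.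
Qed.

Lemma cvgc_nc_le u l (M : R) : u @ \oo --> l -> (forall n, nc (u n) <= M) -> nc l <= M.
Proof.
move=> /cvgc_nc/cvgrP ul h; apply/ler_addgt0Pr => e /ul[N /(_ N (leqnn N))].
by have := h N; rewrite ltr_norml => ? /andP[? ?]; lra.
Qed.

Lemma cvgc_ReIm u l : (fun n => complex.Re (u n)) @ \oo --> complex.Re l ->
  (fun n => complex.Im (u n)) @ \oo --> complex.Im l -> u @ \oo --> l.
Proof.
move=> /cvgrP h1 /cvgrP h2; apply/cvgcP => e e0.
have e20 : 0 < e / 2 by lra.
have [N1 h1N] := h1 _ e20; have [N2 h2N] := h2 _ e20.
exists (maxn N1 N2) => n; rewrite geq_max => /andP[n1 n2].
apply: le_lt_trans (nc_le_ReIm _) _.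
have := h1N n n1; have := h2N n n2.
rewrite -!raddfB /=; lra.
Qed.

Lemma cvgc_Re u l : u @ \oo --> l -> (fun n => complex.Re (u n)) @ \oo --> complex.Re l.
Proof.
move=> /cvgcP h; apply/cvgrP => e e0; have [N hN] := h e e0.
by exists N => n Nn; rewrite -raddfB /=; apply: le_lt_trans (Re_le_nc _) (hN _ Nn).
Qed.
Lemma cvgc_Im u l : u @ \oo --> l -> (fun n => complex.Im (u n)) @ \oo --> complex.Im l.
Proof.
move=> /cvgcP h; apply/cvgrP => e e0; have [N hN] := h e e0.
by exists N => n Nn; rewrite -raddfB /=; apply: le_lt_trans (Im_le_nc _) (hN _ Nn).
Qed.

End Modulus.

(** * Absolutely convergent double series *)

Lemma cvg_sum_ord (K : numFieldType) (V : normedModType K) (n : nat)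
    (u : 'I_n -> nat -> V) (l : 'I_n -> V) :
  (forall i, u i @ \oo --> l i) ->
  (fun N => \sum_(i < n) u i N) @ \oo --> \sum_(i < n) l i.
Proof.
move=> ul; elim: n u l ul => [|n ih] u l ul.
  by under eq_fun do rewrite big_ord0; rewrite big_ord0; exact: cvg_cst.
under eq_fun do rewrite big_ord_recr; rewrite big_ord_recr.
by apply: cvgD => //; apply: ih.
Qed.

Section Series.
Variable R : realType.
Local Notation C := R[i].
Implicit Types (u : nat -> C) (F : nat -> nat -> C) (l : C).

Lemma rseries_cvg (d : nat -> R) (M : R) : (forall n, 0 <= d n) ->
  (forall n, \sum_(k < n) d k <= M) ->
  exists2 l : R, series d @ \oo --> l & forall n, \sum_(k < n) d k <= l <= M.
Proof.
move=> d0 dM.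
have nd : nondecreasing_seq (series d).
  by apply/nondecreasing_seqP => n; rewrite seriesSr lerDl.
have ub : has_ubound (range (series d)).
  by exists M => _ [n _ <-]; rewrite seriesEord; exact: dM.
have cv : cvgn (series d) by exact: nondecreasing_is_cvgn.
exists (limn (series d)) => // n; apply/andP; split.
  by have := nondecreasing_cvgn_le nd cv n; rewrite seriesEord.
by apply: limr_le => //; apply: nearW => k; rewrite seriesEord; exact: dM.
Qed.

Lemma rseries_le_cvg (d e : nat -> R) (M : R) : (forall n, `|d n| <= e n) ->
  (forall n, \sum_(k < n) e k <= M) -> exists l : R, series d @ \oo --> l.
Proof.
move=> de eM; have e0 n : 0 <= e n by apply: le_trans (de n).
have [l el _] := rseries_cvg e0 eM.
have ce : cvgn (series e) by apply/cvg_ex; exists l.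
exists (limn (series d)); apply: normed_cvg.
by apply: (@series_le_cvg _ _ e) => // n; exact: normr_ge0.
Qed.

Lemma series_abs_cvg u (M : R) : (forall n, \sum_(k < n) nc (u k) <= M) ->
  exists2 l, series u @ \oo --> l & nc l <= M.
Proof.
move=> uM.
have [a ha] : exists a : R, series (fun k => complex.Re (u k)) @ \oo --> a.
  by apply: (rseries_le_cvg _ uM) => n; exact: Re_le_nc.
have [b hb] : exists b : R, series (fun k => complex.Im (u k)) @ \oo --> b.
  by apply: (rseries_le_cvg _ uM) => n; exact: Im_le_nc.
have ul : series u @ \oo --> (a +i* b).
  apply: cvgc_ReIm => /=.
    rewrite (_ : (fun n => _) = series (fun k => complex.Re (u k)))//.
    by apply/funext => n; rewrite /series/= raddf_sum.
  rewrite (_ : (fun n => _) = series (fun k => complex.Im (u k)))//.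
  by apply/funext => n; rewrite /series/= raddf_sum.
exists (a +i* b) => //; apply: (cvgc_nc_le ul) => n; rewrite seriesEord.
exact: le_trans (nc_sum _ _ _) _.
Qed.

(** Tannery's theorem: once a convergent series dominates all terms uniformly in
    [N], the tails are uniformly small and the limit passes through the sum. *)
Lemma tannery F (a : nat -> C) (d : nat -> R) (M : R) :
  (forall m, (fun N => F N m) @ \oo --> a m) ->
  (forall N m, nc (F N m) <= d m) -> (forall n, \sum_(k < n) d k <= M) ->
  exists2 T : C, series a @ \oo --> T & (fun N => \sum_(m < N) F N m) @ \oo --> T.
Proof.
move=> Fa Fd dM.
have ad m : nc (a m) <= d m by apply: cvgc_nc_le (Fa m) _ => N.
have d0 m : 0 <= d m by apply: le_trans (ad m); exact: nc_ge0.
have [D dD Db] := rseries_cvg d0 dM.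
have [T aT _] : exists2 T : C, series a @ \oo --> T & nc T <= M.
  by apply: series_abs_cvg => n; apply: le_trans (dM n); apply: ler_sum.
exists T => //.
suff h : (fun N => \sum_(m < N) F N m - series a N) @ \oo --> (0 : C).
  rewrite (_ : (fun N => _) =
    (fun N => (\sum_(m < N) F N m - series a N) + series a N)); last first.
    by apply/funext => N; rewrite subrK.
  by rewrite -[T]add0r; exact: cvgD h aT.
apply/cvgcP => e e0; have e4 : 0 < e / 8 by lra.
have /cvgrP/(_ _ e4)[K hK] := dD.
have hd : (fun N => \sum_(m < K) nc (F N m - a m)) @ \oo --> \sum_(m < K) (0 : R).
  apply: (@cvg_sum_ord R R^o K (fun m N => nc (F N m - a m)) (fun=> 0)) => i.
  exact: (cvgc_ncB (Fa i)).
rewrite big1 in hd => //; have /cvgrP/(_ _ e4)[N0 hN0] := hd.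
exists (maxn K N0) => N; rewrite geq_max => /andP[KN N0N]; rewrite subr0.
rewrite seriesEord -sumrB; apply: le_lt_trans (nc_sum _ _ _) _.
have -> : \sum_(i < N) nc (F N i - a i) =
   \sum_(i < K) nc (F N i - a i) + \sum_(K <= i < N) nc (F N i - a i).
  by rewrite -!(big_mkord xpredT (fun i => nc (F N i - a i))) (big_cat_nat (leq0n _) KN).
have h1 := hN0 N N0N; rewrite subr0 ger0_norm in h1; last first.
  by apply: sumr_ge0 => i _; exact: nc_ge0.
have h2 : \sum_(K <= i < N) nc (F N i - a i) <= \sum_(K <= i < N) (d i + d i).
  apply: ler_sum => i _; apply: le_trans (ncB _ _) _.
  by apply: lerD; [exact: Fd|exact: ad].
have h3 : \sum_(K <= i < N) d i = series d N - series d K.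
  by rewrite /series/= (big_cat_nat (leq0n _) KN)/= addrAC subrr add0r.
have := hK N KN; have := hK K (leqnn K); rewrite !ltr_norml => /andP[? ?] /andP[? ?].
move: h2; rewrite big_split /= h3; lra.
Qed.

(** Tannery's theorem applies to the row sums cut at [N], which are dominated by
    the full sums of absolute values along the rows. *)
Lemma double_series_rows F (M : R) :
  (forall A B, \sum_(m < A) \sum_(i < B) nc (F m i) <= M) ->
  exists (a : nat -> C) (T : C), [/\ forall m, series (F m) @ \oo --> a m,
   series a @ \oo --> T, (fun N => \sum_(m < N) \sum_(i < N) F m i) @ \oo --> T &
   forall n, \sum_(m < n) nc (a m) <= M].
Proof.
move=> FM.
have rowM m B : \sum_(i < B) nc (F m i) <= M.
  apply: le_trans (FM m.+1 B); rewrite big_ord_recr /= lerDr.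
  by apply: sumr_ge0 => ? _; apply: sumr_ge0 => ? _; exact: nc_ge0.
have /choice[d hd] : forall m, exists l : R, series (fun i => nc (F m i)) @ \oo --> l
    /\ forall n, \sum_(k < n) nc (F m k) <= l.
  move=> m; have [l h1 h2] := rseries_cvg (fun n => nc_ge0 (F m n)) (rowM m).
  by exists l; split=> // n; have /andP[] := h2 n.
have /choice[a ha] : forall m, exists l : C, series (F m) @ \oo --> l.
  by move=> m; have [l h1 h2] := series_abs_cvg (rowM m); exists l.
have dM n : \sum_(m < n) d m <= M.
  have h : (fun B => \sum_(m < n) series (fun i => nc (F m i)) B) @ \oo --> \sum_(m < n) d m.
    apply: (@cvg_sum_ord R R^o n (fun m => series (fun i => nc (F m i))) d) => i.
    by have [] := hd i.
  (* A finite sum of rows is approximated by a rectangle. *)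
  apply/ler_addgt0Pr => e e0; have /cvgrP/(_ e e0)[N hN] := h.
  have := hN N (leqnn _); rewrite ltr_norml => /andP[h1 _].
  have := FM n N; rewrite (eq_bigr (fun m : 'I_n => series (fun i => nc (F m i)) N)).
    lra.
  by move=> m _; rewrite seriesEord.
have [T T1 T2] := @tannery (fun N m => \sum_(i < N) F m i) a d M
  ltac:(by move=> m; have := ha m; rewrite seriesEord)
  (fun N m => le_trans (nc_sum _ _ _) (proj2 (hd m) N)) dM.
exists a, T; split=> // n; apply: le_trans (dM n); apply: ler_sum => i _.
apply: cvgc_nc_le (ha i) _ => N; rewrite seriesEord.
exact: le_trans (nc_sum _ _ _) (proj2 (hd i) N).
Qed.

(** The partial sums over squares are symmetric in the two indices and converge
    both to the sum of the row sums and to the sum of the column sums, so that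
    these agree. *)
Lemma double_series F (M : R) :
  (forall A B, \sum_(m < A) \sum_(i < B) nc (F m i) <= M) ->
  exists (a b : nat -> C) (T : C), [/\ forall m, series (F m) @ \oo --> a m,
    forall i, series (fun m => F m i) @ \oo --> b i,
    series a @ \oo --> T, series b @ \oo --> T &
    [/\ (fun N => \sum_(m < N) \sum_(i < N) F m i) @ \oo --> T,
     forall n, \sum_(m < n) nc (a m) <= M & forall n, \sum_(m < n) nc (b m) <= M]].
Proof.
move=> FM; have [a [T [h1 h2 h3 h4]]] := double_series_rows FM.
have FM' A B : \sum_(m < A) \sum_(i < B) nc (F i m) <= M.
  by rewrite exchange_big.
have [b [T' [k1 k2 k3 k4]]] := @double_series_rows (fun i m => F m i) M FM'.
have e : T = T'.
  apply: (cvgc_unique h3); rewrite (_ : (fun N => _) =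
    (fun N => \sum_(m < N) \sum_(i < N) F i m)) //.
  by apply/funext => N; rewrite exchange_big.
rewrite -e in k2; exists a, b, T; split; [exact: h1|exact: k1|exact: h2|exact: k2|].
by split; [exact: h3|exact: h4|exact: k4].
Qed.

End Series.

(** * Power series *)

Section PowerSeries.
Variable R : realType.
Local Notation C := R[i].
Implicit Types (f g : C -> C) (b c d u : nat -> C) (p q v w x y l a : C) (r rho tau M K : R).

(** The norm of a power series in the algebra of series that converge absolutely
    on the closed disk of radius [r] is at most [M]. Finite partial sums make this
    bound stable under all the constructions below. *)
Definition coef_bound c r M := forall n, \sum_(k < n) nc (c k) * r ^+ k <= M.

(** A closed inductive wrapper: as a plain definition, it would unfold to the
    quantified inclusion of filters that convergence stands for. *)
Variant sums_to u l : Prop := SumsTo of series u @ \oo --> l.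

Lemma sums_toE u l : sums_to u l -> series u @ \oo --> l.
Proof. by case. Qed.

Definition power_sum c x l := sums_to (fun k => c k * x ^+ k) l.

Definition expands (f : C -> C) p r :=
  exists c M, coef_bound c r M /\
    forall w, nc (w - p) <= r -> power_sum c (w - p) (f w).

Lemma sums_to_unique u l l' : sums_to u l -> sums_to u l' -> l = l'.
Proof. by move=> [h] [h']; exact: cvgc_unique h h'. Qed.

Lemma series_finite u n : (forall k, (n <= k)%N -> u k = 0) ->
  sums_to u (\sum_(k < n) u k).
Proof.
move=> u0; split; apply/cvgcP => e e0; exists n => N nN.
suff -> : series u N = \sum_(k < n) u k by rewrite subrr nc0.
rewrite /series /= (big_cat_nat (leq0n _) nN) /= big_mkord.
rewrite [X in _ + X]big_nat_cond [X in _ + X]big1 ?addr0// => i /andP[/andP[ni _] _].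
exact: u0.
Qed.

Lemma sums_to_ext u b l : u =1 b -> sums_to u l -> sums_to b l.
Proof. by move=> /funext ->. Qed.

Lemma sums_toZ u x l : sums_to u l ->
  sums_to (fun k => x * u k) (x * l).
Proof.
move=> [ul]; split; rewrite (_ : series _ = (fun n => x * series u n)).
  by apply: cvgM; [exact: cvg_cst|exact: ul].
by apply/funext => n; rewrite /series /= mulr_sumr.
Qed.

Lemma sums_toZr u x l : sums_to u l ->
  sums_to (fun k => u k * x) (l * x).
Proof.
move=> ul; rewrite (mulrC l); apply: (sums_to_ext _ (sums_toZ x ul)) => k.
exact: mulrC.
Qed.

Lemma sums_toD u b l x : sums_to u l -> sums_to b x ->
  sums_to (fun k => u k + b k) (l + x).
Proof.
move=> [ul] [bx]; split; rewrite (_ : series _ = (fun n => series u n + series b n)).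
  exact: (cvgD ul bx).
by apply/funext => n; rewrite /series /= big_split.
Qed.

Lemma sums_to_shift u l m : sums_to u l ->
  sums_to (fun i => if (m <= i)%N then u (i - m)%N else 0) l.
Proof.
move=> [/cvgcP ul]; split; apply/cvgcP => e /ul[N hN]; exists (m + N)%N => n mNn.
have mn : (m <= n)%N by apply: leq_trans mNn; exact: leq_addr.
rewrite /series /= (big_cat_nat (leq0n _) mn)//= big_nat_cond big1 ?add0r; last first.
  by move=> i /andP[/andP[_ im] _]; rewrite leqNgt im.
rewrite -{1}[m]add0n big_addn.
under eq_bigr do rewrite leq_addl addnK.
by apply: hN; rewrite leq_subRL.
Qed.

Lemma coef_bound_ge0 c r M : coef_bound c r M -> 0 <= M.
Proof. by move=> /(_ 0%N); rewrite big_ord0. Qed.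

Lemma coef_bound_le c r r' M : 0 <= r' -> r' <= r -> coef_bound c r M -> coef_bound c r' M.
Proof.
move=> r0 rr h n; apply: le_trans (h n); apply: ler_sum => k _.
by apply: ler_wpM2l; [exact: nc_ge0|rewrite lerXn2r// ?nnegrE (le_trans r0)].
Qed.

Lemma power_sum_exists c r M x : coef_bound c r M -> nc x <= r ->
  exists2 l, power_sum c x l & nc l <= M.
Proof.
move=> cM xr; have cM' := coef_bound_le (nc_ge0 x) xr cM.
have [|l h lM] := @series_abs_cvg _ (fun k => c k * x ^+ k) M.
  by move=> n; under eq_bigr do rewrite ncM ncX; exact: cM'.
by exists l.
Qed.

Lemma expands_le f p r r' : 0 <= r' -> r' <= r -> expands f p r -> expands f p r'.
Proof.
move=> r0 rr [c [M [cM cf]]]; exists c, M; split; first exact: coef_bound_le cM.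
by move=> w wr; apply: cf; apply: le_trans rr.
Qed.

Lemma expands_ext f g p r : (forall w, nc (w - p) <= r -> f w = g w) ->
  expands f p r -> expands g p r.
Proof.
move=> fg [c [M [cM cf]]]; exists c, M; split=> // w wr.
by rewrite -fg//; exact: cf.
Qed.

(** A normally convergent superposition of power series is a power series: its
    coefficients are the column sums [d] of the array [G]. The weights [X] need not
    be powers [x ^+ i]; with the divided differences of the powers in place of
    [X], the same exchange of sums computes the divided differences of the
    superposition. *)
Lemma superposition (G : nat -> nat -> C) tau M : 0 < tau ->
  (forall A B, \sum_(m < A) \sum_(i < B) nc (G m i) * tau ^+ i <= M) ->
  exists2 d, coef_bound d tau M &
  forall (X : nat -> C) K, (forall i, nc (X i) <= K * tau ^+ i) ->
  exists (s : nat -> C) (T : C),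
   [/\ forall m, sums_to (fun i => G m i * X i) (s m),
    sums_to s T, sums_to (fun i => d i * X i) T &
    (fun N => \sum_(m < N) \sum_(i < N) G m i * X i) @ \oo --> T].
Proof.
move=> t0 GM.
have tC : tau%:C != 0 by rewrite -nc_gt0 nc_real gtr0_norm.
have ncG m i : nc (G m i * tau%:C ^+ i) = nc (G m i) * tau ^+ i.
  by rewrite ncM ncX nc_real gtr0_norm.
have GM' A B : \sum_(m < A) \sum_(i < B) nc (G m i * tau%:C ^+ i) <= M.
  by under eq_bigr do under eq_bigr do rewrite ncG.
(* The column sums at the real point tau determine the coefficients. *)
have [_ [l [_ [_ hl _ _ [_ _ lM]]]]] :=
  @double_series _ (fun m i => G m i * tau%:C ^+ i) M GM'.
exists (fun i => l i / tau%:C ^+ i).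
  move=> n; apply: le_trans (lM n); apply: ler_sum => i _.
  by rewrite ncM ncV ncX nc_real gtr0_norm// mulfVK// expf_neq0 ?gt_eqF.
move=> X K XK.
have K0 : 0 <= K by have := le_trans (nc_ge0 _) (XK 0%N); rewrite expr0 mulr1.
have GX A B : \sum_(m < A) \sum_(i < B) nc (G m i * X i) <= M * K.
  apply: le_trans (ler_wpM2r K0 (GM A B)); rewrite mulr_suml; apply: ler_sum => m _.
  rewrite mulr_suml; apply: ler_sum => i _; rewrite ncM -mulrA (mulrC _ K).
  by apply: ler_wpM2l; [exact: nc_ge0|exact: XK].
have [s [e [T [h1 h2 h3 h4 [h5 _ _]]]]] :=
  @double_series _ (fun m i => G m i * X i) (M * K) GX.
exists s, T; split; [by move=> m; split; exact: h1|by split|split|exact: h5].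
suff /sums_toE : sums_to (fun i => l i / tau%:C ^+ i * X i) T by [].
move: (SumsTo h4); apply: sums_to_ext => i.
apply: (sums_to_unique (SumsTo (h2 i))); rewrite -mulrA (mulrC _ (X i)).
move: (sums_toZr (X i / tau%:C ^+ i) (SumsTo (hl i))); apply: sums_to_ext => m.
by rewrite -mulrA (mulrCA _ (X i)) mulfV ?mulr1// expf_neq0.
Qed.

Lemma power_sum_cst a x : power_sum (fun k => a *+ (k == 0%N)) x a.
Proof.
have {2}-> : a = \sum_(k < 1) a *+ (k == 0%N :> nat) * x ^+ k.
  by rewrite big_ord1 expr0 mulr1.
by apply: series_finite => -[|k]// _; rewrite mul0r.
Qed.

Lemma coef_bound_cst a r : coef_bound (fun k => a *+ (k == 0%N)) r (nc a).
Proof.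
case=> [|n]; first by rewrite big_ord0 nc_ge0.
by rewrite big_ord_recl big1 ?addr0 ?expr0 ?mulr1// => i _; rewrite nc0 mul0r.
Qed.

Lemma expands_cst a p r : expands (fun=> a) p r.
Proof.
exists (fun k => a *+ (k == 0%N)), (nc a); split; first exact: coef_bound_cst.
by move=> w _; exact: power_sum_cst.
Qed.

Lemma expands_id p r : 0 <= r -> expands id p r.
Proof.
move=> r0; pose c k : C := if k is k'.+1 then (k' == 0%N)%:R else p.
have c2 n (F : nat -> R) : \sum_(k < n.+2) nc (c k) * F k = nc p * F 0%N + F 1%N.
  rewrite !big_ord_recl big1 ?addr0 => [|i _]; last first.
    by rewrite (_ : c _ = 0)// nc0 mul0r.
  by rewrite (_ : c (lift _ _) = 1)// nc1 mul1r.
exists c, (nc p + r); split.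
  move=> n; have [n2|n2] := leqP 2 n.
    by rewrite -(subnKC n2) add2n (c2 _ (fun k => r ^+ k)) expr0 expr1 mulr1.
  case: n n2 => [|[|n]]// _; rewrite ?big_ord0 ?addr_ge0 ?nc_ge0//.
  by rewrite big_ord1 expr0 mulr1 lerDl.
move=> w _; have {2}-> : w = \sum_(k < 2) c k * (w - p) ^+ k.
  by rewrite !big_ord_recl big_ord0 /= expr0 !mulr1 mul1r addr0 addrC subrK.
by apply: series_finite => -[|[|k]]// _; rewrite mul0r.
Qed.

(** The product is the superposition of the shifted copies [b m * x ^+ m * c] of
    the second factor. *)
Lemma product_expansion b c r B M : 0 < r -> coef_bound b r B -> coef_bound c r M ->
  exists2 d, coef_bound d r (B * M) & forall x l l', nc x <= r ->
    power_sum b x l -> power_sum c x l' -> power_sum d x (l * l').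
Proof.
move=> r0 bB cM.
pose G m i : C := if (m <= i)%N then b m * c (i - m)%N else 0.
have M0 := coef_bound_ge0 cM.
have [|d dM hd] := @superposition G r (B * M) r0.
  move=> A N; apply: le_trans (ler_wpM2r M0 (bB A)); rewrite mulr_suml.
  apply: ler_sum => m _; apply: (@le_trans _ _ (nc (b m) * r ^+ m *
      \sum_(i < N - m) nc (c i) * r ^+ i)); last first.
    apply: ler_wpM2l; last exact: cM.
    by rewrite mulr_ge0 ?nc_ge0// exprn_ge0// ltW.
  rewrite -(big_mkord xpredT (fun i => nc (G m i) * r ^+ i)).
  rewrite -(big_mkord xpredT (fun i => nc (c i) * r ^+ i)) mulr_sumr.
  have [mN|/ltnW Nm] := leqP m N.
    rewrite (big_cat_nat (leq0n _) mN)//= big_nat_cond big1 ?add0r; last first.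
      by move=> i /andP[/andP[_ im] _]; rewrite /G leqNgt im nc0 mul0r.
    rewrite -{1}[m : nat]add0n big_addn; apply: ler_sum => i _.
    rewrite /G leq_addl addnK ncM exprD le_eqVlt; apply/orP; left; apply/eqP.
    ring.
  have -> : (N - m = 0)%N by apply/eqP; rewrite subn_eq0.
  rewrite [leRHS]big_geq// big_nat_cond big1// => i /andP[/andP[_ iN] _].
  by rewrite /G leqNgt (leq_trans iN Nm) nc0 mul0r.
exists d => // x l l' xr bl cl.
have [|s [T [hs sT dT _]]] := hd (fun i => x ^+ i) 1.
  by move=> i; rewrite ncX mul1r lerXn2r// ?nnegrE ?nc_ge0// ltW.
rewrite /power_sum; suff -> : l * l' = T by [].
apply: (fun h => sums_to_unique h sT); move: (sums_toZr l' bl).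
apply: sums_to_ext => m; apply: (fun h => sums_to_unique h (hs m)).
move: (sums_to_shift m (sums_toZ (b m * x ^+ m) cl)).
apply: sums_to_ext => i; rewrite /G; case: leqP => mi; last by rewrite mul0r.
have -> : x ^+ i = x ^+ (i - m) * x ^+ m by rewrite -exprD subnK.
ring.
Qed.

Lemma expandsM f g p r : 0 < r -> expands f p r -> expands g p r ->
  expands (fun w => f w * g w) p r.
Proof.
move=> r0 [b [B [bB bf]]] [c [M [cM cf]]].
have [d dM hd] := product_expansion r0 bB cM.
exists d, (B * M); split=> // w wr.
by apply: hd; [|exact: bf|exact: cf].
Qed.

Lemma expandsX f p r n : 0 < r -> expands f p r -> expands (fun w => f w ^+ n) p r.
Proof.
move=> r0 fp; elim: n => [|n ih]; first exact: expands_cst.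
by under eq_fun do rewrite exprS; exact: expandsM.
Qed.

(** The composite is the superposition of the powers of the inner series, whose
    norms are controlled because the norm is submultiplicative. *)
Lemma composition c (g : nat -> C) tau rho M : 0 < tau ->
  coef_bound g tau rho -> coef_bound c rho M ->
  exists2 d, coef_bound d tau M & forall x y l, nc x <= tau ->
    power_sum g x y -> power_sum c y l -> power_sum d x l.
Proof.
move=> t0 gr cM.
have /choice[h hP] : forall m, exists h, coef_bound h tau (rho ^+ m) /\
    forall x y, nc x <= tau -> power_sum g x y -> power_sum h x (y ^+ m).
  elim=> [|m [h [h1 h2]]].
    exists (fun k => 1 *+ (k == 0%N)); split.
      by rewrite expr0 -(nc1 R); exact: coef_bound_cst.
    by move=> x y _ _; rewrite expr0; exact: power_sum_cst.
  have [d d1 d2] := product_expansion t0 gr h1.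
  exists d; split; first by rewrite exprS.
  by move=> x y xt gy; rewrite exprS; apply: d2 => //; exact: h2.
have [|d dM hd] := @superposition (fun m i => c m * h m i) tau M t0.
  move=> A B; apply: le_trans (cM A); apply: ler_sum => m _.
  under eq_bigr do rewrite ncM -mulrA; rewrite -mulr_sumr.
  apply: ler_wpM2l; first exact: nc_ge0.
  by have [h1 _] := hP m; exact: h1.
exists d => // x y l xt gy cl.
have [|s [T [hs sT dT _]]] := hd (fun i => x ^+ i) 1.
  by move=> i; rewrite ncX mul1r lerXn2r// ?nnegrE ?nc_ge0// ltW.
rewrite /power_sum; suff -> : l = T by [].
apply: (fun h => sums_to_unique h sT); move: cl; apply: sums_to_ext => m.
apply: (fun h => sums_to_unique h (hs m)); have [_ /(_ x y xt gy) h2] := hP m.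
move: (sums_toZ (c m) h2); apply: sums_to_ext => i.
by rewrite mulrA.
Qed.

Definition geometric_coef q k : C := (-1) ^+ k * q^-1 ^+ k.+1.

Lemma nc_geometric_coef q k : nc (geometric_coef q k) = (nc q)^-1 ^+ k.+1.
Proof. by rewrite ncM !ncX ncN nc1 expr1n mul1r ncV. Qed.

Lemma coef_bound_geometric q r : 0 <= r -> r < nc q ->
  coef_bound (geometric_coef q) r (nc q - r)^-1.
Proof.
move=> r0 rq n; have q0 : 0 < nc q by apply: le_lt_trans rq.
under eq_bigr do rewrite nc_geometric_coef exprSr -mulrA (mulrC _^-1) mulrA -exprMn.
rewrite -mulr_suml.
have D0 : 0 < nc q - r by rewrite subr_gt0.
rewrite -(@ler_pM2r _ (nc q - r))// mulVf ?gt_eqF//.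
have -> : (\sum_(i < n) ((nc q)^-1 * r) ^+ i) / nc q * (nc q - r) =
          1 - ((nc q)^-1 * r) ^+ n.
  rewrite -[RHS]opprB subrX1 -mulNr opprB -mulrA mulrC; congr (_ * _).
  by rewrite mulrBr mulVf// gt_eqF.
by rewrite gerBl exprn_ge0// mulr_ge0// invr_ge0 ltW.
Qed.

Lemma power_sum_geometric q x : nc x < nc q ->
  power_sum (geometric_coef q) x (q + x)^-1.
Proof.
move=> xq; have q0 : 0 < nc q by apply: le_lt_trans xq; exact: nc_ge0.
have q0' : q != 0 by rewrite -nc_gt0.
have qx : q + x != 0.
  apply/eqP => h; move: xq; have -> : q = - x by apply/eqP; rewrite -addr_eq0 h.
  by rewrite ncN ltxx.
pose t := nc (x / q).
have t1 : `|t| < 1.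
  by rewrite ger0_norm ?nc_ge0// /t ncM ncV ltr_pdivrMr// mul1r.
split; apply: (@cvgc_0 _ _ _ (fun n => t ^+ n * nc (q + x)^-1)).
  rewrite -(mul0r (nc (q + x)^-1)); apply: cvgM; last exact: cvg_cst.
  exact: cvg_expr.
move=> n; have -> : series (fun k => geometric_coef q k * x ^+ k) n =
    (1 - (- (x / q)) ^+ n) / (q + x).
  rewrite seriesEord; apply: (mulIf qx); rewrite mulfVK// -[RHS]opprB subrX1 -mulNr opprB mulrC.
  rewrite mulr_sumr mulr_sumr; apply: eq_bigr => k _.
  rewrite /geometric_coef [(- (x / q)) ^+ k]exprNn exprMn [q^-1 ^+ k.+1]exprS.
  by field.
rewrite -{2}[(q + x)^-1]mul1r -mulrBl ncM ler_wpM2r ?nc_ge0//.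
by rewrite addrC addKr ncN ncX ncN.
Qed.

Lemma expands_inv a v r : 0 <= r -> r < nc (a - v) -> expands (fun w => (w - v)^-1) a r.
Proof.
move=> r0 rab; exists (geometric_coef (a - v)), (nc (a - v) - r)^-1; split.
  exact: coef_bound_geometric.
move=> w wr; rewrite (_ : w - v = a - v + (w - a)); last by ring.
by apply: power_sum_geometric; exact: le_lt_trans rab.
Qed.

(** Near [a], the function [w^-1 - v] is a geometric series with another constant
    term; its norm on a small disk is close to [nc (a^-1 - v)], hence below
    [rho], and composition applies. The radius [tau] depends only on the two
    centers and on [rho], which later makes it uniform in the parameter. *)
Lemma inversion_expansion v rho a : a != 0 -> nc (a^-1 - v) < rho ->
  exists2 tau, 0 < tau & (forall w, nc (w - a) <= tau -> nc (w^-1 - v) <= rho) /\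
  forall c M, coef_bound c rho M ->
  exists2 d, coef_bound d tau M & forall w l, nc (w - a) <= tau ->
   power_sum c (w^-1 - v) l -> power_sum d (w - a) l.
Proof.
move=> a0 avr; set e := nc (a^-1 - v) in avr *.
have A0 : 0 < nc a by rewrite nc_gt0.
(* The second bound makes 1 / (nc a - tau) - 1 / nc a at most rho - e. *)
pose tau := Num.min (nc a / 2) ((rho - e) * nc a ^+ 2 / 2).
have t0 : 0 < tau.
  rewrite lt_min; apply/andP; split; first by lra.
  by rewrite divr_gt0// mulr_gt0 ?exprn_gt0// subr_gt0.
have ta : tau <= nc a / 2 by rewrite ge_min lexx.
have te : tau <= (rho - e) * nc a ^+ 2 / 2 by rewrite ge_min lexx orbT.
exists tau => //.
pose g k := if k is k'.+1 then geometric_coef a k else a^-1 - v.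
have tau_a : tau < nc a by lra.
have gr : coef_bound g tau rho.
  case=> [|n]; first by rewrite big_ord0; apply: le_trans (ltW avr); exact: nc_ge0.
  have := coef_bound_geometric (ltW t0) tau_a n.+1.
  rewrite !big_ord_recl /= expr0 !mulr1 nc_geometric_coef expr1.
  set S := \sum_(i < n) _; rewrite -/e => hS.
  suff : (nc a - tau)^-1 - (nc a)^-1 <= rho - e by lra.
  have -> : (nc a - tau)^-1 - (nc a)^-1 = tau / ((nc a - tau) * nc a).
    field; apply/andP; split; lra.
  rewrite ler_pdivrMr; last by rewrite mulr_gt0// subr_gt0.
  apply: le_trans te _; rewrite -mulrA; apply: ler_wpM2l; first by lra.
  nra.
have hg w : nc (w - a) <= tau -> power_sum g (w - a) (w^-1 - v).
  move=> wt; have h := @power_sum_geometric a (w - a) (le_lt_trans wt tau_a).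
  have -> : w^-1 - v = (a + (w - a))^-1 - v by rewrite (addrC a) subrK.
  move: (sums_toD h (power_sum_cst (- v) (w - a))); apply: sums_to_ext.
  case=> [|k]; last by rewrite mul0r addr0.
  by rewrite /g /geometric_coef !expr0 !mulr1 expr1 mul1r.
split=> [w wt|c M cM].
  by have [l /(sums_to_unique (hg w wt)) ->] := power_sum_exists gr wt.
have [d dM hd] := composition t0 gr cM.
by exists d => // w l wt cl; apply: hd cl => //; exact: hg.
Qed.

Lemma expands_inversion c f v rho a M : a != 0 -> nc (a^-1 - v) < rho ->
  coef_bound c rho M -> (forall y, nc (y - v) <= rho -> power_sum c (y - v) (f y)) ->
  exists2 tau, 0 < tau & expands (fun w => f w^-1) a tau.
Proof.
move=> a0 av cM cf; have [tau t0 [h1 h2]] := inversion_expansion a0 av.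
have [d dM hd] := h2 c M cM; exists tau => //; exists d, M; split=> // w wt.
by apply: hd => //; apply: cf; exact: h1.
Qed.

(** The coefficients [d] are those of [(f x - f u) / (x - u)], since
    [x ^+ m - u ^+ m] is [(x - u)] times a sum of products of powers. Dividing
    loses only the factor [r - nc u] in the norm, and no radius of convergence. *)
Lemma difference_quotient c (u : C) r M : 0 < r -> nc u < r -> coef_bound c r M ->
  exists2 d, coef_bound d r (M / (r - nc u)) &
  forall (X : nat -> C) K, (forall i, nc (X i) <= K * r ^+ i) ->
  exists2 T : C, sums_to (fun i => d i * X i) T &
    sums_to (fun m => c m * \sum_(i < m) u ^+ (m.-1 - i) * X i) T.
Proof.
move=> r0 ur cM; set q := nc u in ur *.
have q0 : 0 <= q by exact: nc_ge0.
have rq : 0 < r - q by rewrite subr_gt0.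
pose G m i : C := if (i < m)%N then c m * u ^+ (m.-1 - i) else 0.
have [|d dM hd] := @superposition G r (M / (r - q)) r0.
  move=> A B; rewrite ler_pdivlMr//; apply: le_trans (cM A).
  rewrite mulr_suml; apply: ler_sum => m _.
  apply: (@le_trans _ _ (nc (c m) * (r ^+ m - q ^+ m))); last first.
    by rewrite ler_wpM2l ?nc_ge0// gerBl exprn_ge0.
  have -> : r ^+ m - q ^+ m = (r - q) * \sum_(i < m) q ^+ (m.-1 - i) * r ^+ i.
    by rewrite -[LHS]opprB subrXX -mulNr opprB.
  rewrite mulrCA mulrC; apply: ler_wpM2l; [exact: ltW|rewrite mulr_sumr].
  rewrite -(big_mkord xpredT (fun i => nc (G m i) * r ^+ i)).
  apply: (@le_trans _ _ (\sum_(0 <= i < maxn m B) nc (G m i) * r ^+ i)).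
    rewrite [leRHS](@big_cat_nat _ _ _ B) ?leq_maxr//= lerDl.
    by apply: sumr_ge0 => i _; rewrite mulr_ge0 ?nc_ge0// exprn_ge0// ltW.
  rewrite (@big_cat_nat _ _ _ m) ?leq_maxl//=.
  rewrite [X in _ + X]big_nat_cond [X in _ + X]big1 ?addr0; last first.
    by move=> i /andP[/andP[mi _] _]; rewrite /G ltnNge mi nc0 mul0r.
  rewrite big_mkord; apply: ler_sum => i _.
  by rewrite /G ltn_ord ncM ncX -mulrA.
exists d => // X K XK; have [s [T [hs sT dT _]]] := hd X K XK.
exists T; first exact: dT.
move: sT; apply: sums_to_ext => m; apply: (sums_to_unique (hs m)).
rewrite mulr_sumr (eq_bigr (fun i : 'I_m => G m i * X i)); last first.
  by move=> i _; rewrite /G ltn_ord mulrA.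
by apply: series_finite => i mi; rewrite /G ltnNge mi mul0r.
Qed.

End PowerSeries.

(** * Residues *)

Section Residues.
Variable R : realType.
Local Notation C := R[i].
Implicit Types (f g : C -> C) (b c d : nat -> C) (p q u v w x y z l a : C) (r e M : R).

Lemma near_punctured a (P : C -> Prop) : (\forall z \near a^', P z) <->
  exists2 e, 0 < e & forall z, 0 < nc (z - a) < e -> P z.
Proof.
split.
  rewrite near_withinE => /nbhs_ballP[e' /= e0 h].
  have er : e' = (complex.Re e')%:C by rewrite RRe_real// ger0_real// ltW.
  exists (complex.Re e'); first by rewrite -ltcR -er.
  move=> z /andP[z0 ze]; apply: h.
    by rewrite /ball /= er ltc_nc ncBC.
  by rewrite /= -subr_eq0 -nc_gt0.
case=> e e0 h; rewrite near_withinE; apply/nbhs_ballP; exists e%:C.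
  by rewrite /= ltcR.
move=> z; rewrite /ball /= ltc_nc ncBC => ze za; apply: h.
by rewrite ze nc_gt0 subr_eq0 za.
Qed.

Lemma sums_to_drop c n l : sums_to c l ->
  sums_to (fun k => c (n + k)%N) (l - \sum_(k < n) c k).
Proof.
move=> [/cvgcP cl]; split; apply/cvgcP => e /cl[N hN]; exists N => m Nm.
have := hN (n + m)%N (leq_trans Nm (leq_addl _ _)).
rewrite !seriesEord /= big_split_ord /=; congr (_ < e); congr (Normc.normc _); ring.
Qed.

(** Each term of positive degree at [x] is at most [nc x / r] times the same term
    at [r]. *)
Lemma power_sum_near_center c r M x l : 0 < r -> coef_bound c r M -> nc x <= r ->
  power_sum c x l -> nc (l - c 0%N) <= nc x / r * M.
Proof.
move=> r0 cM xr /(sums_to_drop 1)/sums_toE; rewrite big_ord1 expr0 mulr1 => cl.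
apply: (cvgc_nc_le cl) => n; rewrite seriesEord.
apply: le_trans (nc_sum _ _ _) _.
apply: (@le_trans _ _ (nc x / r * \sum_(i < n) nc (c (1 + i)%N) * r ^+ (1 + i))).
  rewrite mulr_sumr; apply: ler_sum => i _; rewrite ncM ncX mulrCA.
  apply: ler_wpM2l; first exact: nc_ge0.
  rewrite !add1n !exprS [leRHS]mulrA mulfVK ?gt_eqF//.
  apply: ler_wpM2l; first exact: nc_ge0.
  by rewrite lerXn2r// ?nnegrE ?nc_ge0// ltW.
apply: ler_wpM2l; first by rewrite divr_ge0 ?nc_ge0// ltW.
apply: le_trans (cM n.+1); rewrite big_ord_recl /= lerDr.
by rewrite mulr_ge0 ?nc_ge0// exprn_ge0// ltW.
Qed.

(** Convergence at [x] bounds the terms there; on a smaller disk they are then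
    dominated by a geometric series. *)
Lemma coef_bound_of_power_sum c x l r : 0 < r -> r < nc x -> power_sum c x l ->
  exists M, coef_bound c r M.
Proof.
move=> r0 rx [/cvgcP/(_ 1 ltr01)[N hN]].
have x0 : 0 < nc x by apply: lt_trans rx.
pose B := 2 + \sum_(k < N) nc (c k * x ^+ k).
have S0 : 0 <= \sum_(k < N) nc (c k * x ^+ k).
  by apply: sumr_ge0 => ? _; exact: nc_ge0.
have cB k : nc (c k) * nc x ^+ k <= B.
  rewrite -ncX -ncM; have [kN|Nk] := ltnP k N.
    rewrite /B (bigD1 (Ordinal kN))//= addrCA lerDl addr_ge0//.
    by apply: sumr_ge0 => ? _; exact: nc_ge0.
  have h1 := hN k Nk; have h2 := hN k.+1 (leqW Nk).
  have -> : c k * x ^+ k = (series (fun k => c k * x ^+ k) k.+1 - l) -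
      (series (fun k => c k * x ^+ k) k - l).
    by rewrite seriesSr; ring.
  apply: le_trans (ncB _ _) _; rewrite /B; lra.
pose t := r / nc x.
have t0 : 0 <= t by rewrite divr_ge0// ltW.
have t1 : t < 1 by rewrite ltr_pdivrMr// mul1r.
exists (B / (1 - t)) => n.
rewrite ler_pdivlMr ?subr_gt0//.
apply: (@le_trans _ _ (B * (\sum_(k < n) t ^+ k) * (1 - t))).
  apply: ler_wpM2r; first by rewrite subr_ge0 ltW.
  rewrite mulr_sumr; apply: ler_sum => k _; rewrite expr_div_n mulrA.
  rewrite ler_pdivlMr ?exprn_gt0// -mulrA (mulrC (r ^+ k)) mulrA.
  by apply: ler_wpM2r (cB k); rewrite exprn_ge0// ltW.
rewrite -mulrA (_ : _ * (1 - t) = 1 - t ^+ n); last first.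
  by rewrite -[RHS]opprB subrX1 -[RHS]mulNr opprB mulrC.
by rewrite ler_piMr ?addr_ge0// gerBl exprn_ge0.
Qed.

Lemma power_sum_drop c x l n : power_sum c x l ->
  power_sum (fun k => c (n + k)%N) x ((l - \sum_(k < n) c k * x ^+ k) / x ^+ n) \/ x = 0.
Proof.
have [->|x0 cl] := eqVneq x 0; [by right|left].
move: (sums_toZr (x ^+ n)^-1 (sums_to_drop n cl)); apply: sums_to_ext => k.
by rewrite exprD (mulrC (x ^+ n)) mulrA mulfK ?expf_neq0.
Qed.

(** The first nonzero coefficient would be the limit at 0 of a quotient that
    vanishes away from 0. *)
Lemma power_sum_identity c e : 0 < e ->
  (forall x, 0 < nc x < e -> power_sum c x 0) -> forall k, c k = 0.
Proof.
move=> e0 h; have e20 : 0 < e / 2 by lra.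
have nce2 : nc (e / 2)%:C = e / 2 by rewrite nc_real gtr0_norm.
have [|||M cM] := @coef_bound_of_power_sum c (e / 2)%:C 0 (e / 4); first lra.
  - by rewrite nce2; lra.
  - by apply: h; rewrite nce2; apply/andP; split; lra.
have e40 : 0 < e / 4 by lra.
elim/ltn_ind => k ih; apply/eqP; rewrite -nc_eq0; apply: contraT => ck.
have ck0 : 0 < nc (c k) by rewrite lt_def ck nc_ge0.
(* The lower coefficients vanish by induction, so x ^+ k can be divided out. *)
have dM : coef_bound (fun j => c (k + j)%N) (e / 4) (M / (e / 4) ^+ k).
  move=> n; rewrite ler_pdivlMr ?exprn_gt0// mulr_suml.
  apply: le_trans (cM (k + n)%N); rewrite big_split_ord /= -[leLHS]add0r.
  apply: lerD; first by apply: sumr_ge0 => ? _; rewrite mulr_ge0 ?nc_ge0// exprn_ge0// ltW.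
  by apply: ler_sum => i _; rewrite -mulrA -exprD (addnC k).
set M' := M / _ in dM.
have M'0 := coef_bound_ge0 dM.
have key x : 0 < nc x -> nc x <= e / 4 -> nc (c k) <= nc x / (e / 4) * M'.
  move=> x0 xe; have x0' : x != 0 by rewrite -nc_gt0.
  have [|H|] := @power_sum_drop c x 0 k; last by move/eqP; rewrite (negbTE x0').
    by apply: h; rewrite x0; apply: le_lt_trans xe _; lra.
  have := power_sum_near_center e40 dM xe H.
  rewrite big1 ?subr0 ?mul0r ?sub0r ?ncN ?addn0//.
  by move=> i _; rewrite ih ?mul0r.
(* Small enough for the bound in key to be below nc (c k). *)
pose t := Num.min (e / 4) (nc (c k) * (e / 4) / (2 * (M' + 1))).
have D0 : 0 < 2 * (M' + 1) by lra.
have t0 : 0 < t by rewrite lt_min e40 divr_gt0// mulr_gt0.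
have te : t <= e / 4 by rewrite ge_min lexx.
have tc : t <= nc (c k) * (e / 4) / (2 * (M' + 1)) by rewrite ge_min lexx orbT.
have := key t%:C; rewrite nc_real gtr0_norm// => /(_ t0 te).
rewrite ler_pdivlMr// in tc.
have -> : t / (e / 4) * M' = t * M' / (e / 4) by ring.
rewrite ler_pdivlMr// => H.
nra.
Qed.

(** A principal part can be padded with zeros, which brings two of them to the same
    length. *)
Lemma is_residue_pad g a w : is_residue g a w -> exists N0, forall N, (N0 <= N)%N ->
  exists b c, [/\ b 0%N = w, (forall k, (N0 < k)%N -> b k = 0) & \forall z \near a^',
    power_sum c (z - a) (g z - \sum_(k < N.+1) b k * (z - a) ^- k.+1)].
Proof.
move=> [N0 [b [c [bw h]]]]; exists N0 => N N0N.
exists (fun k => if (k <= N0)%N then b k else 0), c; split=> //.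
  by move=> k; case: leqP.
apply: filterS h => z hz; split; move: hz; set S1 := \sum_(k < _) _.
set S2 := \sum_(k < _) _; suff -> : S1 = S2 by []; rewrite /S1 /S2.
rewrite -(big_mkord xpredT (fun k => b k * (z - a) ^- k.+1)).
rewrite -[RHS](big_mkord xpredT (fun k => (if (k <= N0)%N then b k else 0) * (z - a) ^- k.+1)).
rewrite [RHS](@big_cat_nat _ _ _ N0.+1)//= [X in _ = _ + X]big_nat_cond.
rewrite [X in _ = _ + X]big1 ?addr0; last first.
  by move=> k /andP[/andP[N0k _] _]; rewrite leqNgt N0k mul0r.
rewrite big_nat_cond [RHS]big_nat_cond; apply: eq_bigr => k /andP[/andP[_ kN] _].
by rewrite -ltnS kN.
Qed.

Lemma is_residue_lin g g' a w w' x : is_residue g a w -> is_residue g' a w' ->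
  is_residue (fun z => g z + x * g' z) a (w + x * w').
Proof.
move=> /is_residue_pad[N hN] /is_residue_pad[N' hN'].
have [b [c [b0 _ hc]]] := hN (maxn N N') (leq_maxl _ _).
have [b' [c' [b0' _ hc']]] := hN' (maxn N N') (leq_maxr _ _).
exists (maxn N N'), (fun k => b k + x * b' k), (fun k => c k + x * c' k).
split; first by rewrite b0 b0'.
move/near_punctured : hc => [e e0 h]; move/near_punctured : hc' => [e' e0' h'].
apply/near_punctured; exists (Num.min e e'); first by rewrite lt_min e0.
move=> z /andP[z0]; rewrite lt_min => /andP[ze ze'].
have h1 := h z; rewrite z0 ze in h1; have h2 := h' z; rewrite z0 ze' in h2.
have H := sums_toD (h1 isT) (sums_toZ x (h2 isT)).
apply: sums_toE.
have -> : g z + x * g' z - \sum_(k < (maxn N N').+1) (b k + x * b' k) * (z - a) ^- k.+1 =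
    g z - \sum_(k < (maxn N N').+1) b k * (z - a) ^- k.+1 +
    x * (g' z - \sum_(k < (maxn N N').+1) b' k * (z - a) ^- k.+1).
  rewrite mulrBr mulr_sumr addrACA -opprD -big_split /=; congr (_ - _).
  by apply: eq_bigr => k _; ring.
by move: H; apply: sums_to_ext => k; ring.
Qed.

Lemma is_residue_ext g g' a w : (\forall z \near a^', g z = g' z) ->
  is_residue g a w -> is_residue g' a w.
Proof.
move=> /near_punctured[e e0 gg] [N [b [c [b0 /near_punctured[e' e0' h]]]]].
exists N, b, c; split; first exact: b0.
apply/near_punctured; exists (Num.min e e'); first by rewrite lt_min e0.
move=> z /andP[z0]; rewrite lt_min => /andP[ze ze'].
by rewrite -gg ?z0//; apply: h; rewrite z0.
Qed.

(** Multiplying by a power of [z - a] turns the principal part and the regular part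
    into a single power series that vanishes near [a], so that its coefficients
    vanish; the residue is one of them. *)
Lemma is_residue0 a w : is_residue (fun=> 0) a w -> w = 0.
Proof.
move=> [N [b [c [<- /near_punctured[e e0 h]]]]].
(* The coefficients of (z - a) ^+ N.+1 times the two parts. *)
pose E k := if (k <= N)%N then b (N - k)%N else c (k - N.+1)%N.
suff /(_ N) : forall k, E k = 0 by rewrite /E leqnn subnn.
apply: (power_sum_identity e0) => x /andP[x0 xe].
have := h (x + a); rewrite addrK x0 xe => /(_ isT) hx.
have x0' : x != 0 by rewrite -nc_gt0.
have S := sums_toZ (x ^+ N.+1) (SumsTo hx).
have F : sums_to (fun k => (if (k < N.+1)%N then E k else 0) * x ^+ k)
     (\sum_(k < N.+1) (if (k < N.+1)%N then E k else 0) * x ^+ k).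
  by apply: series_finite => k Nk; rewrite ltnNge Nk mul0r.
have := sums_toD F (sums_to_shift N.+1 S).
rewrite sub0r mulrN mulr_sumr -sumrN.
rewrite [X in X + _](reindex_inj rev_ord_inj) /= -big_split big1 => [|i _]; last first.
  have iN : (i <= N)%N by rewrite -ltnS.
  rewrite subSS ltnS leq_subr /E leq_subr subKn//.
  have -> : x ^+ N.+1 = x ^+ (N - i) * x ^+ i.+1 by rewrite -exprD addnS subnK.
  have xi : x ^+ i.+1 != 0 by rewrite expf_neq0.
  by move: (x ^+ i.+1) xi => t t0 /=; field.
apply: sums_to_ext => k; rewrite ltnS /E.
have [kN|Nk] := leqP k N; first by rewrite addr0.
rewrite mul0r add0r mulrCA -exprD subnKC//.
Qed.

Lemma is_residue_unique g a w w' : is_residue g a w -> is_residue g a w' -> w = w'.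
Proof.
move=> h h'; have := is_residue_lin (-1) h h'.
rewrite (_ : (fun z => _) = (fun=> 0)) => [/is_residue0/eqP|].
  by rewrite mulN1r subr_eq0 => /eqP.
by apply/funext => z; rewrite mulN1r subrr.
Qed.

Lemma residueE g a w : is_residue g a w -> residue g a = w.
Proof.
move=> h; apply: xget_unique => // y hy; exact: is_residue_unique hy h.
Qed.

Lemma is_residue_regular f a r : 0 < r -> expands f a r -> is_residue f a 0.
Proof.
move=> r0 [c [M [cM cf]]]; exists 0%N, (fun=> 0), c; split=> //.
apply/near_punctured; exists r => // z /andP[_ zr].
rewrite big1 ?subr0 => [|i _]; last by rewrite mul0r.
by apply: sums_toE; apply: cf; exact: ltW.
Qed.

Lemma is_residue_pole a m : is_residue (fun z => (z - a)^-1 ^+ m.+1) a (m == 0%N)%:R.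
Proof.
exists m, (fun k => (m == k)%:R), (fun=> 0); split=> //.
apply: nearW => z; rewrite (bigD1 ord_max)//= eqxx mul1r big1 ?addr0; last first.
  by move=> i; rewrite -val_eqE /= eq_sym => /negbTE ->; rewrite mul0r.
rewrite exprVn subrr.
have := @series_finite R (fun k => 0 * (z - a) ^+ k) 0; rewrite big_ord0.
by move=> /(_ (fun k _ => mul0r _))/sums_toE.
Qed.

End Residues.

(** * Sums of residues over a disk, and divided differences *)

Section ResidueSum.
Variable R : realType.
Local Notation C := R[i].
Implicit Types (f g : C -> C) (p q u v w x y z l a t : C) (r e M : R) (s : seq C).
Variables (p0 : C) (eps : R).
Let D := [set z : C | nc (z - p0) < eps].

(** The residues of [g] in the disk exist, vanish outside the finite set [A], and
    add up to [t]. Linear combinations need the finite set, because a sum over an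
    infinite support is 0 by convention. *)
Definition has_residue_sum g t := exists (rho : C -> C) (A : set C),
  [/\ finite_set A, A `<=` D, forall a, D a -> is_residue g a (rho a),
      forall a, D a -> ~ A a -> rho a = 0 & \sum_(a \in A) rho a = t].

Lemma has_residue_sumE g t : has_residue_sum g t -> residue_sum g p0 eps = t.
Proof.
move=> [rho [A [Af AD Dr A0 <-]]]; rewrite /residue_sum.
have -> : [set z | `|z - p0| < eps%:C] = D by apply/seteqP; split=> z /=; rewrite ltc_nc.
transitivity (\sum_(a \in D) rho a).
  by apply: eq_fsbigr => a /set_mem /Dr /residueE.
by apply/esym/fsbig_widen => // a [Da nAa] /=; exact: A0.
Qed.

Lemma has_residue_sum_lin g g' t t' x : has_residue_sum g t -> has_residue_sum g' t' ->
  has_residue_sum (fun z => g z + x * g' z) (t + x * t').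
Proof.
move=> [rho [A [Af AD Dr A0 <-]]] [rho' [A' [Af' AD' Dr' A0' <-]]].
exists (fun a => rho a + x * rho' a), (A `|` A'); split.
- by rewrite finite_setU.
- by move=> a [/AD|/AD'].
- by move=> a Da; apply: is_residue_lin; [exact: Dr|exact: Dr'].
- move=> a Da nA; rewrite A0 ?A0' ?mulr0 ?addr0// => h; apply: nA; by [left|right].
rewrite fsbig_split ?finite_setU//= -mulr_fsumr; congr (_ + x * _).
  by apply/esym/fsbig_widen => [a|a [[//|/AD' Da] nAa]]; [left|exact: A0].
by apply/esym/fsbig_widen => [a|a [[/AD Da|//] nAa]]; [right|exact: A0'].
Qed.

Lemma has_residue_sum0 f : (forall a, D a -> exists2 r, 0 < r & expands f a r) ->
  has_residue_sum f 0.
Proof.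
move=> h; exists (fun=> 0), set0; split=> //; last by rewrite fsbig_set0.
by move=> a /h[r r0]; exact: is_residue_regular.
Qed.

Lemma has_residue_sumZ g t x : has_residue_sum g t ->
  has_residue_sum (fun z => x * g z) (x * t).
Proof.
move=> /(has_residue_sum_lin x (@has_residue_sum0 (fun=> 0) _)).
rewrite add0r => h; have [a _|rho [A hA]] := h; first by exists 1 => //; exact: expands_cst.
by exists rho, A; move: hA; under eq_fun do rewrite add0r.
Qed.

Lemma D_open a : D a -> exists2 e, 0 < e & forall z, nc (z - a) < e -> D z.
Proof.
rewrite /D /= => Da; exists (eps - nc (a - p0)); first by rewrite subr_gt0.
move=> z /= ze; have -> : z - p0 = (z - a) + (a - p0) by ring.
by apply: le_lt_trans (ncD _ _) _; rewrite -ltrBrDr.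
Qed.

Lemma near_notin_seq a s : exists2 e, 0 < e &
  forall z, 0 < nc (z - a) < e -> z \notin s.
Proof.
elim: s => [|b s [e e0 h]]; first by exists 1.
have [->|ba] := eqVneq b a.
  exists e => // z ze; rewrite inE negb_or h// andbT; apply/eqP => za.
  by move: ze; rewrite za subrr nc0 ltxx.
exists (Num.min e (nc (b - a))); first by rewrite lt_min e0 nc_gt0 subr_eq0.
move=> z /andP[z0]; rewrite lt_min => /andP[ze zb].
rewrite inE negb_or h ?z0// andbT; apply/eqP => zeb.
by move: zb; rewrite zeb ltxx.
Qed.

Lemma has_residue_sum_ext s g g' t :
  (forall z, D z -> z \notin s -> g z = g' z) ->
  has_residue_sum g t -> has_residue_sum g' t.
Proof.
move=> gg [rho [A [Af AD Dr A0 At]]]; exists rho, A.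
split; [exact: Af|exact: AD| |exact: A0|exact: At] => a Da.
apply: is_residue_ext (Dr a Da); apply/near_punctured.
have [e e0 h] := D_open Da; have [e' e0' h'] := near_notin_seq a s.
exists (Num.min e e'); first by rewrite lt_min e0.
move=> z /andP[z0]; rewrite lt_min => /andP[ze ze']; apply: gg; first exact: h.
by apply: h'; rewrite z0.
Qed.

Lemma expands_invX a b m : b != a -> exists2 r, 0 < r & expands (fun z => (z - b)^-1 ^+ m) a r.
Proof.
move=> ba; have n0 : 0 < nc (a - b) by rewrite nc_gt0 subr_eq0 eq_sym.
exists (nc (a - b) / 2); first lra.
by apply: expandsX; [lra|apply: expands_inv; lra].
Qed.

Lemma has_residue_sum_pole a m : D a ->
  has_residue_sum (fun z => (z - a)^-1 ^+ m.+1) (m == 0%N)%:R.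
Proof.
move=> Da; exists (fun b => if b == a then (m == 0%N)%:R else 0), [set a]; split.
- exact: finite_set1.
- by move=> ? ->.
- move=> b _; have [->|ba] := eqVneq b a; first exact: is_residue_pole.
  by have [r r0] := @expands_invX b a m.+1 (ltac:(by rewrite eq_sym)); exact: is_residue_regular.
- by move=> b _ /= /eqP/negbTE ->.
by rewrite fsbig_set1 eqxx.
Qed.

Hypothesis D0 : ~ D 0.

Lemma D_neq0 a : D a -> a != 0.
Proof. by move=> Da; apply/eqP => a0; apply: D0; rewrite -a0. Qed.

Lemma expands_at0 m a : D a -> exists2 r, 0 < r & expands (fun z => z^-1 ^+ m) a r.
Proof.
move=> /D_neq0; rewrite eq_sym => /(expands_invX m)[r r0 h]; exists r => //.
by apply: expands_ext h => z _; rewrite subr0.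
Qed.

(** The residue at infinity vanishes, by the degrees. Algebraically, writing one
    factor [z] as [(z - a) + a] lowers the degree of the numerator. *)
Lemma has_residue_sum_proper a k m : D a -> (k.+2 <= m)%N ->
  has_residue_sum (fun z => z ^+ k * (z - a)^-1 ^+ m) 0.
Proof.
move=> Da; elim: k m => [|k ih] [|[|m]]// km.
  by under eq_fun do rewrite expr0 mul1r; exact: (has_residue_sum_pole m.+1 Da).
have := has_residue_sum_lin a (ih m.+1 km) (ih m.+2 (leqW km)).
rewrite mulr0 addr0; apply: (@has_residue_sum_ext [:: a]) => z _.
rewrite inE => za; have za' : z - a != 0 by rewrite subr_eq0.
by rewrite (exprS z) (exprS _ m.+1); move: (z ^+ k) (_ ^+ m.+1) => b c; field.
Qed.

(** This is the differential form [- dy / \prod_(b <- s) (y - b)] in the coordinate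
    [y = z^-1]. *)
Definition polar s (z : C) := z^-1 ^+ 2 / \prod_(b <- s) (z^-1 - b).

Lemma has_residue_sum_polar1 u : D u^-1 -> has_residue_sum (polar [:: u]) (-1).
Proof.
move=> Du; have u0 : u != 0 by rewrite -invr_eq0; exact: D_neq0.
have h1 : has_residue_sum (fun z => z^-1 ^+ 1) 0.
  by apply: has_residue_sum0 => a /(expands_at0 1).
have := has_residue_sum_lin (-1) h1 (has_residue_sum_pole 0 Du).
rewrite eqxx mulr1 add0r; apply: (@has_residue_sum_ext [:: u^-1]) => z Dz.
rewrite inE => zu; have z0 := D_neq0 Dz.
have zu' : 1 - z * u != 0.
  by apply: contra zu; rewrite subr_eq0 => /eqP h; apply/eqP/(mulIf u0); rewrite -h mulVf.
rewrite /polar big_seq1 !expr1; field.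
rewrite z0 u0 /=.
have -> : 1 + - u * z = 1 - z * u by ring.
have -> : z * u - 1 = - (1 - z * u) by ring.
by rewrite oppr_eq0 zu'.
Qed.

(** With at least two factors the form in [y] has no residue at infinity. If two
    points differ, partial fractions in [y] remove one factor; if all are equal,
    there is a single pole. *)
Lemma has_residue_sum_polar2 s : (forall b, b \in s -> D b^-1) -> (1 < size s)%N ->
  has_residue_sum (polar s) 0.
Proof.
elim: {s}_.+1 {-2}s (ltnSn (size s)) => // N ih s sN sD s2.
case: s sN sD s2 => // a s sN sD s2.
have Da : D a^-1 by apply: sD; rewrite inE eqxx.
have a0 : a != 0 by rewrite -invr_eq0; exact: D_neq0.
have [/all_pred1P sa|] := boolP (all (pred1 a) s).
  have {}sa : a :: s = nseq (size s).+1 a by rewrite sa /= size_nseq.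
  case: s sa s2 {sN sD} => // b s sa _.
  have h := has_residue_sumZ ((- a)^-1 ^+ (size s).+2)
     (@has_residue_sum_proper a^-1 (size s) (size s).+2 Da (leqnn _)).
  rewrite mulr0 in h; move: h; apply: (@has_residue_sum_ext [:: a^-1]) => z Dz.
  rewrite inE => za; have z0 := D_neq0 Dz.
  have za' : 1 - z * a != 0.
    by apply: contra za; rewrite subr_eq0 => /eqP h; apply/eqP/(mulIf a0); rewrite -h mulVf.
  rewrite sa /polar big_nseq iter_mulr_1 [size (b :: s)]/=; move: (size s) => m.
  have -> : z^-1 - a = (1 - z * a) / z by field.
  have -> : z - a^-1 = (1 - z * a) / (- a).
    by field; rewrite ?oppr_eq0.
  move: (1 - z * a) za' => t t0.
  have : z ^+ m.+2 = z ^+ m * z ^+ 2 by rewrite -exprD addn2.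
  have : z ^+ 2 != 0 by rewrite expf_neq0.
  have : z ^+ m != 0 by rewrite expf_neq0.
  move: (m.+2) (z ^+ m) => n Z; rewrite exprVn => Z0 Z2 Zn.
  rewrite !exprVn !expr_div_n Zn; move: (z ^+ 2) Z2 => z2 Z2.
  have ha : (- a) ^+ n != 0 by rewrite expf_neq0// oppr_eq0.
  have ht : t ^+ n != 0 by rewrite expf_neq0.
  by move: ((- a) ^+ n) (t ^+ n) ha ht => A T A0 T0; field; rewrite ?T0 ?A0 ?Z0 ?Z2.
move=> /allPn[b bs /= ba].
have ab0 : a - b != 0 by rewrite subr_eq0 eq_sym.
have Db : D b^-1 by apply: sD; rewrite inE bs orbT.
have ps : perm_eq (a :: s) (a :: b :: rem b s) by rewrite perm_cons perm_to_rem.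
have sr : size s = (size (rem b s)).+1 by rewrite (perm_size (perm_to_rem bs)).
set s' := rem b s in ps sr.
have sD' c : c \in s' -> D c^-1 by move=> /mem_rem cs; apply: sD; rewrite inE cs orbT.
(* Both terms of the partial fraction have the same residue sum, -1 or 0. *)
have key c : D c^-1 -> has_residue_sum (polar (c :: s')) (if s' is [::] then -1 else 0).
  move=> Dc; case: (s') sr sD' => [_ _|d s'' sr sD']; first exact: has_residue_sum_polar1.
  apply: ih => //.
    by move: sN; rewrite /= sr.
  by move=> e; rewrite inE => /orP[/eqP ->//|]; exact: sD'.
have := has_residue_sumZ (a - b)^-1 (has_residue_sum_lin (-1) (key a Da) (key b Db)).
have -> x : (x : C) + -1 * x = 0 by ring.
rewrite mulr0; apply: (@has_residue_sum_ext [:: a^-1; b^-1]) => z Dz.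
have z0 := D_neq0 Dz.
have b0 : b != 0 by rewrite -invr_eq0; exact: D_neq0.
rewrite !inE negb_or => /andP[za zb].
have za' : z^-1 - a != 0 by rewrite subr_eq0; apply: contra za => /eqP <-; rewrite invrK.
have zb' : z^-1 - b != 0 by rewrite subr_eq0; apply: contra zb => /eqP <-; rewrite invrK.
rewrite /polar (perm_big _ ps) !big_cons /= !invfM.
move: (\prod_(_ <- _) _)^-1 => P.
have -> : a - b = (z^-1 - b) - (z^-1 - a) by ring.
have : (z^-1 - b) - (z^-1 - a) != 0 by rewrite (_ : _ - _ = a - b)//; ring.
move: (z^-1 - a) (z^-1 - b) za' zb' => A B A0 B0 AB.
by field; rewrite ?A0 ?B0 ?AB ?z0.
Qed.

(** The divided difference of the function [y ^+ m] at the points [a :: s]; it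
    satisfies the recursion of [difference_quotient]. *)
Fixpoint divdiff_pow a s m : C :=
  if s is b :: s' then \sum_(i < m) a ^+ (m.-1 - i) * divdiff_pow b s' i else a ^+ m.

Lemma nc_divdiff_pow a s r : 0 < r -> nc a < r -> (forall b, b \in s -> nc b < r) ->
  exists K, forall m, nc (divdiff_pow a s m) <= K * r ^+ m.
Proof.
move=> r0; elim: s a => [|b s ih] a ar sr.
  by exists 1 => m; rewrite mul1r ncX lerXn2r// ?nnegrE ?nc_ge0// ltW.
have [||K hK] := ih b; first by apply: sr; rewrite inE eqxx.
  by move=> c cs; apply: sr; rewrite inE cs orbT.
have K0 : 0 <= K by have := le_trans (nc_ge0 _) (hK 0%N); rewrite expr0 mulr1.
exists (K / (r - nc a)) => m /=; apply: le_trans (nc_sum _ _ _) _.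
rewrite mulrAC ler_pdivlMr ?subr_gt0//.
apply: (@le_trans _ _ (K * (\sum_(i < m) nc a ^+ (m.-1 - i) * r ^+ i) * (r - nc a))).
  apply: ler_wpM2r; first by rewrite subr_ge0 ltW.
  rewrite mulr_sumr; apply: ler_sum => i _; rewrite ncM ncX mulrCA.
  by apply: ler_wpM2l; [rewrite exprn_ge0 ?nc_ge0|exact: hK].
rewrite -mulrA; apply: ler_wpM2l; first exact: K0.
have -> : (\sum_(i < m) nc a ^+ (m.-1 - i) * r ^+ i) * (r - nc a) = r ^+ m - nc a ^+ m.
  by rewrite -[RHS]opprB subrXX -[RHS]mulNr opprB mulrC.
by rewrite gerBl exprn_ge0// nc_ge0.
Qed.

(** Division of a power series by [y - u], on the level of functions and on the
    level of the functionals of [superposition]. *)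
Lemma deflation c f v r M u : 0 < r -> nc (u - v) < r -> coef_bound c r M ->
  (forall y, nc (y - v) <= r -> power_sum c (y - v) (f y)) ->
  exists d f1, [/\ coef_bound d r (M / (r - nc (u - v))),
    forall y, nc (y - v) <= r -> power_sum d (y - v) (f1 y),
    forall y, nc (y - v) <= r -> f y = f u + (y - u) * f1 y &
    forall (X : nat -> C) K, (forall i, nc (X i) <= K * r ^+ i) ->
    exists2 T : C, sums_to (fun i => d i * X i) T &
    sums_to (fun m => c m * \sum_(i < m) (u - v) ^+ (m.-1 - i) * X i) T].
Proof.
move=> r0 ur cM cf; have [d dM hd] := difference_quotient r0 ur cM.
have /choice[f1 hf1] : forall y, exists l, nc (y - v) <= r -> power_sum d (y - v) l.
  move=> y; have [yr|yr] := leP (nc (y - v)) r; last by exists 0.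
  by have [l hl _] := power_sum_exists dM yr; exists l.
exists d, f1; split=> // y yr.
have [|t ht ht'] := hd (fun i => (y - v) ^+ i) 1.
  by move=> i; rewrite mul1r ncX lerXn2r// ?nnegrE ?nc_ge0// ltW.
have <- : t = f1 y by apply: sums_to_unique ht _; exact: hf1.
apply: (sums_to_unique (cf _ yr)).
have := sums_toD (cf _ (ltW ur)) (sums_toZ (y - u) ht').
apply: sums_to_ext => m; rewrite mulrCA -mulrDr; congr (_ * _).
have -> : y - u = - ((u - v) - (y - v)) by ring.
by rewrite mulNr -subrXX opprB addrC subrK.
Qed.

(** Newton interpolation: splitting off [f u] leaves [f1], the difference quotient,
    with one point fewer. The term [f u] contributes only when [u] is the last
    point, by [has_residue_sum_polar1] and [has_residue_sum_polar2], and the rest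
    is regular once all points are used. *)
Lemma has_residue_sum_divdiff c f v r M u s T : 0 < r -> coef_bound c r M ->
  (forall y, nc (y - v) <= r -> power_sum c (y - v) (f y)) ->
  (forall z, D z -> nc (z^-1 - v) < r) ->
  (forall b, b \in u :: s -> D b^-1) ->
  sums_to (fun m => c m * divdiff_pow (u - v) [seq b - v | b <- s] m) T ->
  has_residue_sum (fun z => f z^-1 * polar (u :: s) z) (- T).
Proof.
move=> r0 cM cf Dv.
have Dv' b : D b^-1 -> nc (b - v) < r by move=> /Dv; rewrite invrK.
elim: s u c f M cM cf T => [|b s ih] u c f M cM cf T sD hT.
  have Du : D u^-1 by apply: sD; rewrite inE eqxx.
  have [d [f1 [dM df ff1 hd]]] := deflation r0 (Dv' _ Du) cM cf.
  have -> : T = f u by apply: sums_to_unique hT _; apply: cf; apply/ltW/Dv'.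
  have reg : has_residue_sum (fun z => f1 z^-1 * z^-1 ^+ 2) 0.
    apply: has_residue_sum0 => a Da.
    have [tau t0 h1] := expands_inversion (D_neq0 Da) (Dv _ Da) dM df.
    have [rr rr0 h2] := expands_at0 2 Da.
    have m0 : 0 < Num.min tau rr by rewrite lt_min t0.
    exists (Num.min tau rr) => //; apply: expandsM => //.
      by apply: expands_le h1; [exact: ltW|rewrite ge_min lexx].
    by apply: expands_le h2; [exact: ltW|rewrite ge_min lexx orbT].
  have := has_residue_sum_lin (f u) reg (has_residue_sum_polar1 Du).
  rewrite mulrN1 add0r; apply: (@has_residue_sum_ext [:: u^-1]) => z Dz.
  rewrite inE => zu; have zu' : z^-1 - u != 0.
    by rewrite subr_eq0; apply: contra zu => /eqP <-; rewrite invrK.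
  rewrite (ff1 z^-1) ?ltW ?Dv// /polar big_seq1.
  by move: (z^-1 - u) (z^-1 ^+ 2) (f1 z^-1) zu' => y t y1 y0; field.
have Du : D u^-1 by apply: sD; rewrite inE eqxx.
have [d [f1 [dM df ff1 hd]]] := deflation r0 (Dv' _ Du) cM cf.
have sD' (e : C) : e \in b :: s -> D e^-1 by move=> es; apply: sD; rewrite inE es orbT.
have [||K hK] := @nc_divdiff_pow (b - v) [seq z - v | z <- s] r r0.
- by apply: Dv'; apply: sD'; rewrite inE eqxx.
- by move=> _ /mapP[e es ->]; apply: Dv'; apply: sD'; rewrite inE es orbT.
have [T' dT' cT'] := hd _ K hK.
have -> : T = T' by exact: sums_to_unique hT cT'.
have h2 : has_residue_sum (polar (u :: b :: s)) 0 by exact: has_residue_sum_polar2.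
have := has_residue_sum_lin (f u) (ih b d f1 _ dM df T' sD' dT') h2.
rewrite mulr0 addr0; apply: (@has_residue_sum_ext [:: u^-1]) => z Dz.
rewrite inE => zu; have zu' : z^-1 - u != 0.
  by rewrite subr_eq0; apply: contra zu => /eqP <-; rewrite invrK.
rewrite (ff1 z^-1) ?ltW ?Dv// /polar [in RHS]big_cons [X in _ + f u * (_ / X)]big_cons.
rewrite !invfM; move: (z^-1 ^+ 2) (\prod_(_ <- _) _)^-1 (f1 z^-1) => t P y1.
by move: (z^-1 - u) zu' => y y0; field.
Qed.

End ResidueSum.

(** * Dirichlet integrals over the simplex *)

Section DirichletIntegral.
Variable R : realType.
Local Notation TR := (measurableTypeR R).
Local Notation mu := (@lebesgue_measure R).

Lemma integral_poly (p : {poly R}) (a b : R) : a <= b ->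
  (\int[mu]_(x in `[a, b]) ((p^`()).[x])%:E = (p.[b] - p.[a])%:E)%E.
Proof.
rewrite le_eqVlt => /predU1P[->|ab].
  by rewrite set_itv1 integral_set1 subrr.
rewrite (@continuous_FTC2 R (horner p^`()) (horner p))//.
- by apply: continuous_subspaceT; exact: continuous_horner.
- split; first by move=> x _; exact: derivable_horner.
    by apply: cvg_at_right_filter; exact: continuous_horner.
  by apply: cvg_at_left_filter; exact: continuous_horner.
- by move=> x _; rewrite derivE.
Qed.

(** The primitive obtained by integrating [x ^+ b * (L - x) ^+ N] by parts [N]
    times. *)
Fixpoint beta_primitive (L : R) (b N : nat) : {poly R} :=
  if N is N'.+1 then
    (b.+1%:R^-1)%:P * ('X ^+ b.+1 * (L%:P - 'X) ^+ N'.+1) +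
    (N'.+1%:R * b.+1%:R^-1)%:P * beta_primitive L b.+1 N'
  else (b.+1%:R^-1)%:P * 'X ^+ b.+1.

Lemma deriv_beta_primitive L b N :
  (beta_primitive L b N)^`() = 'X ^+ b * (L%:P - 'X) ^+ N.
Proof.
have hc k : (k.+1%:R^-1)%:P * k.+1%:R = 1 :> {poly R}.
  by rewrite -polyC_natr -polyCM mulVf ?pnatr_eq0.
elim: N b => [|N ih] b /=.
  rewrite derivM derivC mul0r add0r derivXn -(mulr_natl ('X ^+ _)) mulrA hc.
  by rewrite mul1r expr0 mulr1.
rewrite derivD !derivM !derivC ih derivXn deriv_exp derivB derivC derivX /=.
rewrite polyCM polyC_natr.
transitivity ((b.+1%:R^-1)%:P * b.+1%:R * ('X ^+ b * (L%:P - 'X) ^+ N.+1)).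
  by rewrite (exprS _ b); move: (_^-1)%:P => c; ring.
by rewrite hc mul1r.
Qed.

Lemma beta_primitive0 L b N : (beta_primitive L b N).[0] = 0.
Proof.
elim: N b => [|N ih] b /=; rewrite !hornerE /= ?ih.
  by rewrite !(expr0n, mul0r, mulr0, addr0).
by rewrite !(expr0n, mul0r, mulr0, addr0).
Qed.

Lemma beta_primitiveL L b N : (beta_primitive L b N).[L] =
  (b`! * N`!)%:R / (b + N).+1`!%:R * L ^+ (b + N).+1.
Proof.
have f0 m : (m`!%:R : R) != 0 by rewrite pnatr_eq0 -lt0n fact_gt0.
have fS m : (m.+1)`!%:R = m.+1%:R * m`!%:R :> R by rewrite factS natrM.
have S0 m : (m.+1%:R : R) != 0 by rewrite pnatr_eq0.
elim: N b => [|N ih] b.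
  have -> : (beta_primitive L b 0).[L] = b.+1%:R^-1 * L ^+ b.+1 by rewrite !hornerE.
  rewrite addn0 fact0 muln1 fS; congr (_ * _).
  by move: (b.+1%:R : R) (f0 b) (S0 b) => x b0 x0; field; rewrite b0 x0.
have -> : (beta_primitive L b N.+1).[L] = N.+1%:R / b.+1%:R * (beta_primitive L b.+1 N).[L].
  have e : (L%:P - 'X).[L] = 0 by rewrite !hornerE subrr.
  have e' : ((L%:P - 'X) ^+ N.+1).[L] = 0 by rewrite horner_exp e expr0n.
  by rewrite [beta_primitive L b N.+1]/= hornerD !hornerM e' !hornerC !mulr0 add0r.
rewrite ih addSnnS mulrA; congr (_ * _);
  rewrite [((b.+1)`! * N`!)%:R]natrM [(b`! * (N.+1)`!)%:R]natrM !fS.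
move: (b.+1%:R : R) (N.+1%:R : R) (b`!%:R : R) (N`!%:R : R) (S0 b) => x y z t x0.
have := f0 (b + N.+1)%N; have := S0 (b + N.+1)%N.
by move: ((_ + _).+1%:R : R) (_`!%:R : R) => k m k0 m0; field; rewrite x0 k0 m0.
Qed.

Lemma integral_beta L b N : 0 <= L ->
  (\int[mu]_(x in `[0%R, L]) (x ^+ b * (L - x) ^+ N)%:E =
   ((b`! * N`!)%:R / (b + N).+1`!%:R * L ^+ (b + N).+1)%:E)%E.
Proof.
move=> L0; transitivity (((beta_primitive L b N).[L] - (beta_primitive L b N).[0])%:E).
  by rewrite -integral_poly//; apply: eq_integral => x _; rewrite deriv_beta_primitive !hornerE.
by rewrite beta_primitive0 subr0 beta_primitiveL.
Qed.

(** The integrand [(L - \sum t) ^+ b0 * \prod t ^+ b] on the simplex of size [L],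
    extended by 0. Peeling off the first coordinate [x] leaves the same function
    on the simplex of size [L - x], which is the form that Tonelli's theorem
    needs. *)
Fixpoint dirichlet (L : R) (b0 : nat) (b : seq nat) (t : seq R) : R :=
  match b, t with
  | k :: b', x :: t' => if 0 <= x then x ^+ k * dirichlet (L - x) b0 b' t' else 0
  | _, _ => if 0 <= L then L ^+ b0 else 0
  end.

Lemma dirichlet_ge0 L b0 b t : 0 <= dirichlet L b0 b t.
Proof.
elim: b L t => [|k b ih] L [|x t] /=; try by case: ifP => // ?; rewrite exprn_ge0.
by case: ifP => // ?; rewrite mulr_ge0// exprn_ge0.
Qed.

Lemma dirichlet_lt0 L b0 b t : L < 0 -> dirichlet L b0 b t = 0.
Proof.
move=> L0; elim: b L L0 t => [|k b ih] L L0 [|x t] /=; rewrite 1?leNgt ?L0//.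
by case: ltP => // x0; rewrite ih ?mulr0// ltrBlDr (lt_le_trans L0)// add0r.
Qed.

Lemma measurable_dirichlet n b0 b :
  measurable_fun setT (fun p : TR * n.-tuple TR => dirichlet p.1 b0 b p.2).
Proof.
have h0 m : measurable_fun setT (fun p : TR * m.-tuple TR =>
    if 0 <= (p.1 : R) then (p.1 : R) ^+ b0 else 0).
  apply: measurable_fun_ifT => //.
    by apply: measurable_fun_ler => //; exact: measurable_fst.
  by apply: measurable_funX; exact: measurable_fst.
elim: n b => [|n ih] [|k b].
- by apply: eq_measurable_fun (h0 _) => -[L t] _ /=; case: (tval t).
- by apply: eq_measurable_fun (h0 _) => -[L t] _ /=; rewrite tuple0.
- by apply: eq_measurable_fun (h0 _) => -[L t] _ /=; case: (tval t).
have mh : measurable_fun setT (fun p : TR * n.+1.-tuple TR => thead p.2 : TR).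
  by apply: measurableT_comp => //; apply: measurable_tnth.
apply: (eq_measurable_fun (fun p : TR * n.+1.-tuple TR =>
    if 0 <= thead p.2 :> R then (thead p.2 : R) ^+ k *
      dirichlet ((p.1 : R) - thead p.2) b0 b [tuple of behead p.2] else 0)).
  by move=> [L t] _ /=; rewrite [in RHS](tuple_eta t).
apply: measurable_fun_ifT => //; first exact: measurable_fun_ler.
apply: measurable_funM; first exact: measurable_funX.
have mp : measurable_fun setT (fun p : TR * n.+1.-tuple TR =>
    ((p.1 : R) - thead p.2 : TR, [tuple of behead p.2] : n.-tuple TR)).
  apply: measurable_fun_pair.
    by apply: measurable_funB => //; exact: measurable_fst.
  exact: (measurableT_comp (@measurable_behead _ TR n) measurable_snd).
exact: (measurableT_comp (ih b) mp).
Qed.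

Lemma measurable_dirichletr n L b0 b :
  measurable_fun setT (fun t : n.-tuple TR => dirichlet L b0 b t).
Proof.
have mp : measurable_fun setT (fun t : n.-tuple TR => (L : TR, t)).
  by apply: measurable_fun_pair.
exact: (measurableT_comp (@measurable_dirichlet n b0 b) mp).
Qed.

Definition dirichlet_const (b0 : nat) (b : seq nat) : R :=
  (b0`! * \prod_(k <- b) k`!)%:R / (size b + b0 + sumn b)`!%:R.

(** By Tonelli's theorem the integral over the remaining coordinates is a multiple
    of a power of [L - x], and the integral over [x] is a beta integral. *)
Lemma integral_dirichlet n L b0 b : size b = n ->
  (\int[lebesgue_tuple n]_t (dirichlet L b0 b t)%:E =
   (if 0 <= L then dirichlet_const b0 b * L ^+ (n + b0 + sumn b) else 0)%:E)%E.
Proof.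
elim: n L b => [|n ih] L [|k b]// => [_|[bn]].
  rewrite integral_dirac//; last first.
    by apply/measurable_EFinP; exact: measurable_dirichletr.
  rewrite /dirichlet_const big_nil muln1 [size _]/= [sumn _]/=.
  rewrite !(add0n, addn0) divff ?mul1r ?pnatr_eq0 -?lt0n ?fact_gt0//.
  by rewrite diracE in_setT mul1e.
have mD : measurable_fun setT (fun t : n.+1.-tuple TR => (dirichlet L b0 (k :: b) t)%:E).
  by apply/measurable_EFinP; exact: measurable_dirichletr.
have E := ge0_integral_pushforward (@measurable_tuple_cons R n)
  (mu \x lebesgue_tuple n)%E measurableT mD.
have {}E := E ltac:(by move=> t _ /=; rewrite lee_fin; exact: (dirichlet_ge0 L b0 (k :: b))).
refine (etrans _ (etrans E _)).
  by apply: eq_measure_integral => //; exact: measurable_tuple_cons.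
rewrite preimage_setT fubini_tonelli1; last 2 first.
  by apply: (measurableT_comp mD); exact: measurable_tuple_cons.
  by move=> p; exact: (dirichlet_ge0 L b0 (k :: b) (tuple_cons p)).
(* The inner integral is c * (L - x) ^+ N for x between 0 and L, else 0. *)
pose c := dirichlet_const b0 b; set N := (n + b0 + sumn b)%N.
have c0 : 0 <= c by rewrite divr_ge0.
transitivity (\int[mu]_x (((fun x : R => (c * (x ^+ k * (L - x) ^+ N))%:E) \_ `[0%R, L]) x))%E.
  apply: eq_integral => x _; rewrite /fubini_F /=.
  rewrite /patch; case: ifPn => [|xL].
    rewrite inE /= in_itv /= => /andP[x0 xL]; rewrite x0.
    under eq_integral do rewrite EFinM.
    rewrite ge0_integralZl_EFin; last 4 first.
    - exact: measurableT.
    - by move=> t _; rewrite lee_fin dirichlet_ge0.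
    - by apply/measurable_EFinP; exact: measurable_dirichletr.
    - by rewrite exprn_ge0.
    by rewrite ih// subr_ge0 xL -EFinM; congr (_%:E); rewrite /N /c; ring.
  case: (leP 0 x) xL => x0; last by rewrite integral0.
  rewrite notin_setE /= in_itv /= x0 /= => /negP; rewrite -ltNge => Lx.
  by under eq_integral do rewrite dirichlet_lt0 ?subr_lt0// mulr0; rewrite integral0.
rewrite -integral_mkcond; have [L0|L0] := leP 0 L; last first.
  by rewrite set_itv_ge ?integral_set0// -leNgt bnd_simp.
under eq_integral do rewrite EFinM.
rewrite ge0_integralZl_EFin; last 4 first.
- exact: measurable_itv.
- move=> x /=; rewrite in_itv /= => /andP[x0 xL].
  by rewrite lee_fin mulr_ge0// exprn_ge0// subr_ge0.
- apply/measurable_EFinP; apply: measurable_funTS.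
  apply: measurable_funM; first exact: measurable_funX.
  by apply: measurable_funX; exact: measurable_funB.
- exact: c0.
rewrite integral_beta// -EFinM; congr (_%:E).
have eN : ((size (k :: b)) + b0 + sumn (k :: b) = (k + N).+1)%N.
  by rewrite /N /= bn; lia.
rewrite /c /dirichlet_const eN bn -/N big_cons.
have -> : (n.+1 + b0 + sumn (k :: b) = (k + N).+1)%N by rewrite -eN /= bn.
rewrite mulrA; congr (_ * _); rewrite (mulnCA b0`!).
rewrite [(k`! * (b0`! * _))%:R]natrM [(k`! * N`!)%:R]natrM.
have f0 m : (m`!%:R : R) != 0 by rewrite pnatr_eq0 -lt0n fact_gt0.
have := f0 N; have := f0 (k + N).+1.
move: (N`!%:R : R) ((k + N).+1`!%:R : R) => x y x0 y0.
by field; rewrite x0 y0.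
Qed.

Fixpoint monomial (b : seq nat) (t : seq R) : R :=
  if (b, t) is (k :: b', x :: t') then x ^+ k * monomial b' t' else 1.

Lemma dirichletE L b0 b t : size b = size t -> dirichlet L b0 b t =
  if all (fun x => 0 <= x) t && (0 <= L - \sum_(x <- t) x)
  then (L - \sum_(x <- t) x) ^+ b0 * monomial b t else 0.
Proof.
elim: b L t => [|k b ih] L [|x t]//= => [_|[bt]]; first by rewrite big_nil subr0 mulr1.
rewrite big_cons opprD addrA ih//; case: ifP => //= x0.
by case: ifP => _; rewrite ?mulr0//; ring.
Qed.

Lemma monomial_ge0 b t : all (fun x => 0 <= x) t -> 0 <= monomial b t.
Proof.
elim: b t => [|k b ih] [|x t]//= /andP[x0 t0].
by rewrite mulr_ge0 ?exprn_ge0 ?ih.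
Qed.

Lemma measurable_monomial n b :
  measurable_fun setT (fun t : n.-tuple TR => monomial b t : TR).
Proof.
elim: n b => [|n ih] [|k b].
- exact: measurable_cst.
- apply: (eq_measurable_fun (fun _ : 0.-tuple TR => 1 : TR)); last exact: measurable_cst.
  by move=> t _; rewrite tuple0.
- exact: measurable_cst.
apply: (eq_measurable_fun (fun t : n.+1.-tuple TR =>
    (thead t : R) ^+ k * monomial b [tuple of behead t])).
  by move=> t _ /=; rewrite [in RHS](tuple_eta t).
apply: measurable_funM; first by apply: measurable_funX; exact: measurable_tnth.
exact: (measurableT_comp (ih b) (@measurable_behead _ TR n)).
Qed.

End DirichletIntegral.

Section SimplexMoments.
Variables (R : realType) (n : nat).
Local Notation TR := (measurableTypeR R).

Lemma ge0_integral_simplex_volume (g : n.+1.-tuple TR -> \bar R) :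
  measurable_fun setT g -> (forall a, simplex a -> 0 <= g a)%E ->
  (\int[@simplex_volume R n]_(a in simplex) g a =
   \int[lebesgue_tuple n]_(t in simplex_chart @^-1` simplex) g (simplex_chart t))%E.
Proof.
move=> mg g0.
have mgs : measurable_fun simplex g by apply: measurable_funTS.
have E := ge0_integral_pushforward (@measurable_simplex_chart R n)
  (lebesgue_tuple n) (@measurable_simplex R n) mgs.
have {}E := E ltac:(by move=> a /set_mem /g0).
refine (etrans _ E); apply: eq_measure_integral; first exact: measurable_simplex_chart.
by move=> H A mA As; rewrite /= /simplex_volume (setIidl As).
Qed.

Lemma simplex_chartP (t : n.-tuple TR) : simplex (simplex_chart t) <->
  all (fun x : R => 0 <= x) t && (0 <= 1 - \sum_(x <- t) (x : R)).
Proof.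
have e : \sum_(i < n) (tnth t i : R) = \sum_(x <- t) (x : R) by rewrite big_tuple.
rewrite /simplex /=; split.
  move=> [h _]; apply/andP; split.
    apply/all_tnthP => i; have := h (lift ord0 i).
    by rewrite /simplex_chart tnthS.
  by have := h ord0; rewrite /simplex_chart tnth0 e.
move=> /andP[/all_tnthP h1 h2]; split.
  move=> j; case: (unliftP ord0 j) => [i|] ->; rewrite /simplex_chart ?tnthS ?tnth0 ?e//.
rewrite big_ord_recl tnth0 [X in _ + X](eq_bigr (fun i => tnth t i : R)) ?subrK//.
by move=> i _; rewrite tnthS.
Qed.

Lemma integral_simplex_volume b0 b : size b = n ->
  (\int[@simplex_volume R n]_(a in simplex) (monomial (b0 :: b) a)%:E =
   (dirichlet_const R b0 b)%:E)%E.
Proof.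
move=> bn; rewrite ge0_integral_simplex_volume; last 2 first.
- by apply/measurable_EFinP; exact: measurable_monomial.
- move=> a [a0 _]; rewrite lee_fin monomial_ge0//; apply/all_tnthP => i; exact: a0.
rewrite integral_mkcond.
have := @integral_dirichlet R n 1 b0 b bn.
rewrite ler01 expr1n mulr1 => <-.
apply: eq_integral => t _; rewrite /patch dirichletE ?size_tuple//.
case: ifPn => [|].
  rewrite inE => /simplex_chartP ->; congr (_%:E); rewrite /simplex_chart /=.
  by rewrite big_tuple.
by rewrite notin_setE => h; case: ifPn => // /simplex_chartP.
Qed.

End SimplexMoments.

(** * The mean of a power of a linear form over the simplex *)

Section HomogeneousPowers.
Variable R : realType.
Local Notation C := R[i].
Implicit Types (a b u : C) (s : seq C).

(** The complete homogeneous symmetric polynomial of degree [k]. *)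
Fixpoint homogeneous s k : C :=
  if s is u :: s' then \sum_(i < k.+1) u ^+ i * homogeneous s' (k - i)%N else (k == 0%N)%:R.

Lemma homogeneous1 u k : homogeneous [:: u] k = u ^+ k.
Proof.
have -> : homogeneous [:: u] k =
    \sum_(i < k.+1) u ^+ i * (subn k (nat_of_ord i) == 0%N)%:R by [].
rewrite (bigD1 ord_max)//= subnn eqxx mulr1; apply/eqP.
rewrite -subr_eq0 addrAC subrr add0r; apply/eqP/big1 => i.
rewrite -val_eqE /= => ik; suff -> : (subn k i == 0%N) = false by rewrite mulr0.
by move: ik (ltn_ord i) => /= ? ?; lia.
Qed.

(** The classical formula for the divided differences of a power. The vanishing
    for small exponents says that divided differences of order [size s] kill the
    polynomials of smaller degree. *)
Lemma divdiff_pow_homogeneous a s :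
  (forall m, (m < size s)%N -> divdiff_pow a s m = 0) /\
  (forall k, divdiff_pow a s (k + size s)%N = homogeneous (a :: s) k).
Proof.
elim: s a => [|b s ih] a; first by split=> // k; rewrite addn0 homogeneous1.
have [ih1 ih2] := ih b; split=> [m ms|k].
  by rewrite /= big1// => i _; rewrite ih1 ?mulr0//; move: (ltn_ord i) ms => /= ? ?; lia.
have -> : homogeneous [:: a, b & s] k =
    \sum_(i < k.+1) a ^+ (k - i) * homogeneous (b :: s) i.
  rewrite [LHS]/= (reindex_inj rev_ord_inj) /=; apply: eq_bigr => i _.
  by rewrite subSS subKn// -ltnS.
rewrite [LHS]/= addnS -(big_mkord xpredT
  (fun i => a ^+ ((k + size s).+1.-1 - i) * divdiff_pow b s i)).
rewrite (big_cat_nat (leq0n _) (leqW (leq_addl k (size s)))) /=.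
rewrite big_nat_cond big1 ?add0r => [|i /andP[/andP[_ si] _]]; last by rewrite ih1 ?mulr0.
rewrite -{1}[size s]add0n big_addn subSn ?leq_addl// addnK big_mkord.
by apply: eq_bigr => i _; rewrite ih2 subnDr.
Qed.

(** The coefficients and exponents of the multinomial expansion of the [k]-th power
    of the linear form with coefficients [s]. *)
Fixpoint multinomial_terms s k : seq (C * seq nat) :=
  if s is u :: s' then
    flatten [seq [seq ('C(k, i)%:R * u ^+ i * x.1, i :: x.2) | x <- multinomial_terms s' (k - i)%N]
            | i <- iota 0 k.+1]
  else if k == 0%N then [:: (1, [::])] else [::].

Lemma multinomial_terms_cons u s k : multinomial_terms (u :: s) k =
  flatten [seq [seq ('C(k, i)%:R * u ^+ i * x.1, i :: x.2) | x <- multinomial_terms s (k - i)%N]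
          | i <- iota 0 k.+1].
Proof. by []. Qed.

Lemma multinomial_termsE s (t : seq R) k : size s = size t ->
  \sum_(x <- multinomial_terms s k) x.1 * (monomial x.2 t)%:C =
  (\sum_(p <- zip s t) p.1 * p.2%:C) ^+ k.
Proof.
elim: s t k => [|u s ih] [|y t] k // => [_|[st]].
  rewrite /= big_nil expr0n; case: (k == 0%N); last by rewrite big_nil.
  by rewrite big_seq1 mulr1.
rewrite multinomial_terms_cons [zip _ _]/= big_cons addrC exprDn.
rewrite big_flatten big_map -(big_mkord xpredT
  (fun i => (\sum_(p <- zip s t) p.1 * p.2%:C) ^+ (k - i) * (u * y%:C) ^+ i *+ 'C(k, i))) /=.
rewrite /index_iota subn0; apply: eq_bigr => i _.
rewrite big_map -ih// -(mulr_natl (_ * (u * y%:C) ^+ i)) mulr_suml mulr_sumr.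
apply: eq_bigr => x _ /=.
by rewrite rmorphM rmorphXn exprMn /=; ring.
Qed.

Lemma multinomial_terms_size s k : forall x, x \in multinomial_terms s k ->
  size x.2 = size s /\ sumn x.2 = k.
Proof.
elim: s k => [|u s ih] k x.
  by rewrite /=; case: eqP => [->|//]; rewrite inE => /eqP ->.
rewrite multinomial_terms_cons.
move=> /allpairsPdep[i [y [+ /ih[y1 y2] ->]]].
rewrite mem_iota add0n ltnS => /andP[_ ik].
by rewrite /= y1 y2 subnKC.
Qed.

(** The factorials of the moments cancel the multinomial coefficients, so that all
    monomials get the same weight. *)
Lemma multinomial_terms_fact s k :
  \sum_(x <- multinomial_terms s k) x.1 * (\prod_(i <- x.2) i`!)%:R = k`!%:R * homogeneous s k.
Proof.
elim: s k => [|u s ih] k.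
  rewrite /=; case: eqP => [->|_]; last by rewrite big_nil mulr0.
  by rewrite big_seq1 big_nil.
rewrite multinomial_terms_cons big_flatten big_map [homogeneous _ _]/= mulr_sumr.
rewrite -(big_mkord xpredT (fun i => k`!%:R * (u ^+ i * homogeneous s (k - i)%N))).
rewrite /index_iota subn0 big_seq [RHS]big_seq; apply: eq_bigr => i.
rewrite mem_iota add0n ltnS => /andP[_ ik].
rewrite big_map -(bin_fact ik) 2!natrM.
transitivity ('C(k, i)%:R * u ^+ i * i`!%:R *
    \sum_(x <- multinomial_terms s (k - i)%N) x.1 * (\prod_(j <- x.2) j`!)%:R).
  rewrite mulr_sumr; apply: eq_bigr => x _ /=; rewrite big_cons natrM; ring.
rewrite ih; ring.
Qed.

End HomogeneousPowers.

Section SimplexMean.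
Variables (R : realType) (n : nat).
Local Notation C := R[i].
Local Notation TR := (measurableTypeR R).
Local Notation T := (n.+1.-tuple TR).
Local Notation P := (@simplex_measure R n).
Local Notation mean := (@complex_integral R _ T P simplex).

Lemma simplex_volumeT : @simplex_volume R n setT = (n`!%:R^-1)%:E.
Proof.
have := @integral_simplex_volume R n 0 (nseq n 0%N) (size_nseq _ _).
rewrite (eq_integral (fun=> 1%:E)); last first.
  move=> a _; congr (_%:E); have : forall m (t : seq R), monomial (nseq m 0%N) t = 1.
    by elim=> [|m ih] [|x t] //=; rewrite expr0 mul1r.
  by move=> /(_ n.+1 a).
rewrite integral_cst; last exact: measurable_simplex.
rewrite mul1e /dirichlet_const size_nseq sumn_nseq mul0n !addn0 fact0 mul1n.
rewrite big1_seq ?mul1r => [<-|i /andP[_ /nseqP[-> _]]]//.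
by rewrite [RHS]/= /simplex_volume setIid setTI.
Qed.

Lemma ge0_integral_simplex_measure (g : T -> \bar R) :
  measurable_fun setT g -> (forall a, simplex a -> 0 <= g a)%E ->
  (\int[P]_(a in simplex) g a = n`!%:R%:E * \int[@simplex_volume R n]_(a in simplex) g a)%E.
Proof.
move=> mg g0; have f0 : 0 <= n`!%:R :> R by [].
have <- := @ge0_integral_mscale _ _ R (@simplex_volume R n) simplex
  (@measurable_simplex R n) (NngNum f0) g (measurable_funTS mg) g0.
apply: eq_measure_integral => A _ _.
have e : (@simplex_volume R n : measure T R) setT = (n`!%:R^-1)%:E := simplex_volumeT.
rewrite /simplex_measure [LHS]/= /mnormalize e eqe [_ == +oo%E]/= orbF.
by rewrite gt_eqF ?invr_gt0 ?ltr0n ?fact_gt0//= invrK /mscale /= muleC.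
Qed.

(** The moments of the uniform distribution on the simplex. *)
Definition moment (b : seq nat) : R :=
  n`!%:R * (\prod_(i <- b) i`!)%:R / (n + sumn b)`!%:R.

Lemma integral_monomial b : size b = n.+1 ->
  (\int[P]_(a in simplex) (monomial b a)%:E = (moment b)%:E)%E.
Proof.
case: b => // b0 b [bn]; rewrite ge0_integral_simplex_measure; last 2 first.
- by apply/measurable_EFinP; exact: measurable_monomial.
- move=> a [a0 _]; rewrite lee_fin monomial_ge0//; apply/all_tnthP => i; exact: a0.
rewrite integral_simplex_volume// -EFinM /moment /dirichlet_const bn big_cons /= addnA.
by rewrite mulrA.
Qed.

Lemma integrable_monomial b : size b = n.+1 ->
  P.-integrable simplex (EFin \o (fun a => monomial b a)).
Proof.
move=> bn; apply/integrableP; split.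
  by apply/measurable_EFinP/measurable_funTS; exact: measurable_monomial.
rewrite (eq_integral (fun a : T => (monomial b a)%:E)); last first.
  move=> a /set_mem[a0 _] /=; rewrite ger0_norm// monomial_ge0//.
  by apply/all_tnthP => i; exact: a0.
by rewrite integral_monomial// ltry.
Qed.

Definition mean_integrable (f : T -> C) :=
  P.-integrable simplex (EFin \o (fun a => complex.Re (f a))) /\
  P.-integrable simplex (EFin \o (fun a => complex.Im (f a))).

Lemma meanD f g : mean_integrable f -> mean_integrable g ->
  mean_integrable (fun a => f a + g a) /\ mean (fun a => f a + g a) = mean f + mean g.
Proof.
move=> [f1 f2] [g1 g2]; have mS := @measurable_simplex R n.
split; first split.
- rewrite (_ : _ \o _ = (EFin \o (fun a => complex.Re (f a))) \+
    (EFin \o (fun a => complex.Re (g a)))); first exact: integrableD.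
  by apply/funext => a; rewrite /= raddfD.
- rewrite (_ : _ \o _ = (EFin \o (fun a => complex.Im (f a))) \+
    (EFin \o (fun a => complex.Im (g a)))); first exact: integrableD.
  by apply/funext => a; rewrite /= raddfD.
rewrite /complex_integral; under eq_Rintegral do rewrite raddfD /=.
under [X in _ +i* X]eq_Rintegral do rewrite raddfD /=.
by rewrite !RintegralD.
Qed.

Lemma mean_monomial c b : size b = n.+1 ->
  mean_integrable (fun a => c * (monomial b a)%:C) /\
  mean (fun a => c * (monomial b a)%:C) = c * (moment b)%:C.
Proof.
move=> bn; have mS := @measurable_simplex R n; have ib := integrable_monomial bn.
have cR (x : R) : complex.Re (c * x%:C) = complex.Re c * x.
  by case: c => c1 c2 /=; rewrite mulr0 subr0.
have cI (x : R) : complex.Im (c * x%:C) = complex.Im c * x.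
  by case: c {cR} => c1 c2 /=; rewrite mulr0 add0r mulrC.
have eb : \int[P]_(a in simplex) monomial b a = moment b.
  by rewrite /Rintegral integral_monomial.
split; first split.
- rewrite (_ : _ \o _ = (fun a : T => (complex.Re c)%:E * (monomial b a)%:E)%E).
    by apply: (integrableZl mS (complex.Re c) ib).
  by apply/funext => a; rewrite /= -EFinM cR.
- rewrite (_ : _ \o _ = (fun a : T => (complex.Im c)%:E * (monomial b a)%:E)%E).
    by apply: (integrableZl mS (complex.Im c) ib).
  by apply/funext => a; rewrite /= -EFinM cI.
rewrite /complex_integral; under eq_Rintegral do rewrite cR.
under [X in _ +i* X]eq_Rintegral do rewrite cI.
by rewrite !RintegralZl// eb; apply/eqP; rewrite eq_complex cR cI !eqxx.
Qed.

Lemma mean_sum (I : eqType) (l : seq I) (f : I -> T -> C) (m : I -> C) :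
  (forall i, i \in l -> mean_integrable (f i) /\ mean (f i) = m i) ->
  mean_integrable (fun a => \sum_(i <- l) f i a) /\
  mean (fun a => \sum_(i <- l) f i a) = \sum_(i <- l) m i.
Proof.
elim: l => [|i l ih] h.
  have [z1 z2] := @mean_monomial 0 (nseq n.+1 0%N) (size_nseq _ _).
  have -> : (fun a : T => \sum_(i <- [::]) f i a) =
      (fun a : T => 0 * (monomial (nseq n.+1 0%N) a)%:C).
    by apply/funext => a; rewrite big_nil mul0r.
  by rewrite z2 big_nil mul0r.
have [f1 f2] := h i (mem_head _ _).
have [|g1 g2] := ih; first by move=> j jl; apply: h; rewrite inE jl orbT.
have [k1 k2] := meanD f1 g1.
have -> : (fun a : T => \sum_(i0 <- i :: l) f i0 a) =
    (fun a : T => f i a + \sum_(i0 <- l) f i0 a).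
  by apply/funext => a; rewrite big_cons.
by rewrite big_cons k2 f2 g2.
Qed.

(** The Hermite-Genocchi formula for a power: the moments of the monomials turn the
    multinomial expansion into a complete homogeneous polynomial, which is a
    divided difference. *)
Lemma mean_pow (u : n.+1.-tuple C) k :
  let f (a : T) := (\sum_(j < n.+1) (tnth a j : R)%:C * tnth u j) ^+ k in
  mean_integrable f /\
  mean f = (n`! * k`!)%:R / (n + k)`!%:R * divdiff_pow (thead u) (behead u) (k + n).
Proof.
move=> f; have fE : f = (fun a : T => \sum_(x <- multinomial_terms u k) x.1 * (monomial x.2 a)%:C).
  apply/funext => a; rewrite multinomial_termsE ?size_tuple// /f; congr (_ ^+ k).
  rewrite -[zip u a]/(tval [tuple of zip u a]) big_tuple; apply: eq_bigr => j _.
  rewrite (tnth_nth (0, 0)) /= nth_zip ?size_tuple//= mulrC.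
  by rewrite (tnth_nth (0 : R)) (tnth_nth 0).
have [|h1 h2] := @mean_sum _ (multinomial_terms u k) (fun x a => x.1 * (monomial x.2 a)%:C)
    (fun x => x.1 * (moment x.2)%:C).
  move=> x /multinomial_terms_size[xs _]; apply: mean_monomial; by rewrite xs size_tuple.
rewrite fE; split; first exact: h1.
rewrite h2; have [_ hd] := divdiff_pow_homogeneous (thead u) (behead u).
have := hd k; rewrite size_behead size_tuple [n.+1.-1]/= => ->.
rewrite (_ : thead u :: behead u = u); last by rewrite [in RHS](tuple_eta u).
transitivity ((n`!%:R / (n + k)`!%:R) *
    \sum_(x <- multinomial_terms u k) x.1 * (\prod_(i <- x.2) i`!)%:R :> C).
  rewrite mulr_sumr big_seq [RHS]big_seq; apply: eq_bigr => x /multinomial_terms_size[_ xk].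
  rewrite /moment xk rmorphM rmorphM fmorphV /= !rmorph_nat; ring.
by rewrite multinomial_terms_fact (natrM _ n`!); ring.
Qed.

(** Dominated convergence for the real and imaginary parts; a constant dominates,
    because the simplex has mass 1. *)
Lemma mean_dominated (f_ : nat -> T -> C) (f : T -> C) (M : R) :
  (forall N, mean_integrable (f_ N)) ->
  (forall N a, simplex a -> nc (f_ N a) <= M) ->
  (forall a, simplex a -> (fun N => f_ N a) @ \oo --> f a) ->
  (fun N => mean (f_ N)) @ \oo --> mean f.
Proof.
move=> fi fM ff; have mS := @measurable_simplex R n.
have key (h_ : nat -> T -> R) (h : T -> R) :
  (forall N, P.-integrable simplex (EFin \o h_ N)) ->
  (forall N a, simplex a -> `|h_ N a| <= M) ->
  (forall a, simplex a -> (fun N => h_ N a) @ \oo --> h a) ->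
  (fun N => \int[P]_(a in simplex) h_ N a) @ \oo --> \int[P]_(a in simplex) h a.
  move=> hi hM hh.
  have mh N : measurable_fun simplex (EFin \o h_ N) by have /integrableP[] := hi N.
  have hhE a : simplex a -> (fun N => (h_ N a)%:E) @ \oo --> (h a)%:E.
    by move=> sa; apply: cvg_EFin; [exact: nearW|exact: hh].
  have mhl : measurable_fun simplex (EFin \o h).
    by apply: (emeasurable_fun_cvg _ _ mh) => a /hhE.
  have [] := @dominated_convergence _ _ R P simplex mS (fun N => EFin \o h_ N)
     (EFin \o h) (cst M%:E) mh mhl.
  - by apply: aeW => a; exact: hhE.
  - by apply: finite_measure_integrable_cst.
  - by apply: aeW => a N sa /=; rewrite lee_fin; exact: hM.
  move=> hint _ hcvg; apply: fine_cvg.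
  rewrite fineK; last exact: integrable_fin_num.
  exact: hcvg.
apply: cvgc_ReIm => /=.
  apply: key => [N|N a sa|a sa]; first by have [] := fi N.
    by apply: le_trans (fM N a sa); exact: Re_le_nc.
  by apply: cvgc_Re; exact: ff.
apply: key => [N|N a sa|a sa]; first by have [] := fi N.
  by apply: le_trans (fM N a sa); exact: Im_le_nc.
by apply: cvgc_Im; exact: ff.
Qed.

End SimplexMean.

(** * Power series in several variables: slices and continuity *)

Lemma rV_ballP (R : realType) (m : nat) (x y : 'rV[R[i]]_m) (e : R) : 0 < e ->
  `|x - y| < e%:C <-> forall k, nc (x 0 k - y 0 k) < e.
Proof.
move=> e0; have E : `|x - y| < e%:C <-> ball x e%:C y by rewrite -ball_normE.
split=> [/E|h].
  by move=> [_ h] k; have := h 0 k; rewrite -ball_normE /ball_ /= ltc_nc.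
apply/E; split; first by rewrite ltcR.
by move=> i j; rewrite ord1 -ball_normE /ball_ /= ltc_nc.
Qed.

Lemma near_rVP (R : realType) (m : nat) (a : 'rV[R[i]]_m) (Q : 'rV[R[i]]_m -> Prop) :
  (\forall z \near a, Q z) ->
  exists2 e : R, 0 < e & forall z : 'rV[R[i]]_m, (forall k, nc (z 0 k - a 0 k) < e) -> Q z.
Proof.
move=> /nbhs_ballP[e' /= e0 h].
have er : e' = (complex.Re e')%:C by rewrite RRe_real// ger0_real// ltW.
have e0' : 0 < complex.Re e' by rewrite -ltcR -er.
exists (complex.Re e') => // z hz; apply: h; rewrite er -ball_normE /ball_ /= distrC.
exact/rV_ballP.
Qed.

Section Boxes.
Variable R : realType.
Local Notation C := R[i].

Definition box_index m N (q : {ffun 'I_m -> 'I_N}) : {ffun 'I_m -> nat} :=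
  [ffun k => nat_of_ord (q k)].

Lemma box_index_inj m N : injective (@box_index m N).
Proof.
move=> q q' /ffunP h; apply/ffunP => k; apply/val_inj.
by have := h k; rewrite !ffunE.
Qed.

Lemma box_bound m (f : {ffun 'I_m -> nat} -> R) :
  (forall q, 0 <= f q) -> summable setT (fun q => (f q)%:E) ->
  exists M, forall N, \sum_(q : {ffun 'I_m -> 'I_N}) f (box_index q) <= M.
Proof.
move=> f0; rewrite /summable => fs.
have E : \esum_(q in [set: {ffun 'I_m -> nat}]) `|(f q)%:E|%E \is a fin_num.
  by rewrite ge0_fin_numE// esum_ge0.
exists (fine (\esum_(q in [set: {ffun 'I_m -> nat}]) `|(f q)%:E|%E)) => N.
rewrite -lee_fin fineK// -sumEFin.
pose s := [seq box_index q | q <- enum {ffun 'I_m -> 'I_N}].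
apply: ereal_sup_ubound; exists [set` s]; first by split => //; exact: finite_seq.
rewrite -fsbig_seq; last by rewrite map_inj_uniq ?enum_uniq//; exact: box_index_inj.
rewrite big_map big_enum /=; apply: eq_bigr => q _.
by rewrite ger0_norm.
Qed.

(** The shell between two consecutive boxes, which turns the limit of box sums
    into the sum of a series. *)
Lemma box_split (V : nmodType) m N (f : {ffun 'I_m -> nat} -> V) : (0 < N)%N ->
  \sum_(q : {ffun 'I_m -> 'I_N.+1}) f (box_index q) =
  \sum_(q : {ffun 'I_m -> 'I_N}) f (box_index q) +
  \sum_(q : {ffun 'I_m -> 'I_N.+1} | ~~ [forall k, q k < N]%N) f (box_index q).
Proof.
case: N => // N _.
rewrite (bigID (fun q : {ffun 'I_m -> 'I_N.+2} => [forall k, q k < N.+1]%N)) /=; congr (_ + _).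
pose h (q : {ffun 'I_m -> 'I_N.+1}) : {ffun 'I_m -> 'I_N.+2} :=
  [ffun k => widen_ord (leqnSn _) (q k)].
pose g (q : {ffun 'I_m -> 'I_N.+2}) : {ffun 'I_m -> 'I_N.+1} := [ffun k => inord (q k)].
rewrite (reindex_onto h g) /=; last first.
  move=> q /forallP qN; apply/ffunP => k; apply/val_inj.
  by rewrite !ffunE /= inordK.
apply: eq_big => [q|q _]; last first.
  by congr f; apply/ffunP => k; rewrite !ffunE.
apply/andP; split; first by apply/forallP => k; rewrite ffunE /=.
by apply/eqP/ffunP => k; rewrite !ffunE; apply/val_inj; rewrite /= inord_val.
Qed.

Definition snoc_index d T (q : {ffun 'I_d -> T}) (j : T) : {ffun 'I_(d + 1) -> T} :=
  [ffun k : 'I_(d + 1) => match fintype.split k with inl i => q i | inr _ => j end].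

Lemma box_cons (V : nmodType) d N (f : {ffun 'I_(d + 1) -> nat} -> V) :
  \sum_(q : {ffun 'I_(d + 1) -> 'I_N}) f (box_index q) =
  \sum_(j < N) \sum_(q : {ffun 'I_d -> 'I_N})
    f (snoc_index (box_index q) (nat_of_ord j)).
Proof.
rewrite pair_big /=.
pose h (x : 'I_N * {ffun 'I_d -> 'I_N}) : {ffun 'I_(d + 1) -> 'I_N} :=
  snoc_index x.2 x.1.
pose g (q : {ffun 'I_(d + 1) -> 'I_N}) : 'I_N * {ffun 'I_d -> 'I_N} :=
  (q (rshift d ord0), [ffun i => q (lshift 1 i)]).
rewrite (reindex h) /=; last first.
  exists g => [[j q] _|q _].
    rewrite /g /h; congr pair; first by rewrite /= ffunE (unsplitK (inr ord0)).
    by apply/ffunP => i; rewrite !ffunE (unsplitK (inl i)).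
  apply/ffunP => k; rewrite ffunE /=; case: splitP => i ki; rewrite ?ffunE.
    by congr (q _); apply/val_inj.
  by congr (q _); apply/val_inj; rewrite /= ki (ord1 i).
apply: eq_bigr => -[j q] _; congr f; apply/ffunP => k; rewrite !ffunE /=.
by case: fintype.split => // i; rewrite ffunE.
Qed.

End Boxes.

Section Slices.
Variable R : realType.
Local Notation C := R[i].

Lemma nc_pterm m (c : {ffun 'I_m -> nat} -> C) (z : 'rV_m) q :
  nc (pterm c z q) = nc (c q) * \prod_(k < m) nc (z 0 k) ^+ q k.
Proof. by rewrite ncM nc_prod; under eq_bigr do rewrite ncX. Qed.

Lemma abs_convergent_bound m (c : {ffun 'I_m -> nat} -> C) (z : 'rV_m) :
  abs_convergent c z -> exists M, forall N,
  \sum_(q : {ffun 'I_m -> 'I_N}) nc (pterm c z (box_index q)) <= M.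
Proof.
move=> h; apply: (@box_bound _ m (fun q => nc (pterm c z q))).
  by move=> q; exact: nc_ge0.
by move: h; rewrite /abs_convergent; under eq_fun do rewrite -nc_Re.
Qed.

Lemma box_sumE m (c : {ffun 'I_m -> nat} -> C) z N :
  box_sum c z N = \sum_(q : {ffun 'I_m -> 'I_N}) pterm c z (box_index q).
Proof. by []. Qed.

Section Slice.
Variables (d : nat) (c : {ffun 'I_(d + 1) -> nat} -> C) (x : 'rV[C]_d) (r M : R).
Hypotheses (r0 : 0 < r).
Hypothesis (cM : forall N, \sum_(q : {ffun 'I_(d + 1) -> 'I_N})
  nc (pterm c (zjoin x r%:C) (box_index q)) <= M).

Let join (q : {ffun 'I_d -> nat}) j : {ffun 'I_(d + 1) -> nat} := snoc_index q j.

Let t j q : C := c (join q j) * \prod_(k < d) x 0 k ^+ q k.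

Let pterm_join t0 q j : pterm c (zjoin x t0) (join q j) = t j q * t0 ^+ j.
Proof.
rewrite /pterm /t big_split_ord /= big_ord1 -mulrA; congr (_ * (_ * _)).
  by apply: eq_bigr => k _; rewrite ffunE (unsplitK (inl k)) /zjoin row_mxEl.
by rewrite ffunE (unsplitK (inr ord0)) /zjoin row_mxEr mxE eqxx mulr1n.
Qed.

Let e N j : C := if N is 0%N then 0 else \sum_(q : {ffun 'I_d -> 'I_N}) t j (box_index q).
Let E N j : R := if N is 0%N then 0 else \sum_(q : {ffun 'I_d -> 'I_N}) nc (t j (box_index q)).

Let eE N j : nc (e N.+1 j - e N j) <= E N.+1 j - E N j.
Proof.
case: N => [|N]; first by rewrite /e /E !subr0; exact: nc_sum.
have aux (V : zmodType) (A S : V) : A + S - A = S by rewrite addrAC subrr add0r.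
by rewrite /e /E (box_split (t j))// (box_split (fun q => nc (t j q)))// !aux; exact: nc_sum.
Qed.

Let E_mono N N' j : (N <= N')%N -> E N j <= E N' j.
Proof.
move=> /subnK <-; elim: (N' - N)%N => // k ih; apply: le_trans ih _.
by rewrite addSn -subr_ge0; apply: le_trans (eE _ _); exact: nc_ge0.
Qed.

Let EM K : \sum_(j < K) E K j * r ^+ j <= M.
Proof.
apply: le_trans (cM K); rewrite (box_cons _ (fun q => nc (pterm c (zjoin x r%:C) q))).
apply: ler_sum => j _; case: K j => [|K] j; first by case: j.
rewrite /E mulr_suml.
apply: ler_sum => q _; rewrite -/(join (box_index q) j).
by rewrite pterm_join ncM ncX nc_real gtr0_norm.
Qed.

(** The shells of the boxes in the first [d] indices form the rows of a double
    array whose columns are indexed by the exponent of the last variable. The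
    partial sums over its squares are the box sums, and its column sums are the
    coefficients of the slice. *)
Lemma slice_power_series : exists2 b, coef_bound b r M &
  forall (w l : C), nc w <= r -> box_sum c (zjoin x w) @ \oo --> l -> power_sum b w l.
Proof.
have tel A j : \sum_(i < A) (e i.+1 j - e i j) = e A j.
  by rewrite -(big_mkord xpredT (fun i => e i.+1 j - e i j)) telescope_sumr// subr0.
have telE A j : \sum_(i < A) (E i.+1 j - E i j) = E A j.
  by rewrite -(big_mkord xpredT (fun i => E i.+1 j - E i j)) telescope_sumr// subr0.
have [A B|b bM hb] := @superposition R (fun i j => e i.+1 j - e i j) r M r0.
  rewrite exchange_big /=; apply: le_trans (EM (maxn A B)).
  apply: (@le_trans _ _ (\sum_(j < B) E (maxn A B) j * r ^+ j)).
    apply: ler_sum => j _; rewrite -mulr_suml; apply: ler_wpM2r; first by rewrite exprn_ge0// ltW.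
    apply: le_trans (E_mono j (leq_maxl A B)); rewrite -telE.
    by apply: ler_sum => i _; exact: eE.
  rewrite -!(big_mkord xpredT (fun j => E (maxn A B) j * r ^+ j)).
  rewrite [leRHS](big_cat_nat (leq0n _) (leq_maxr A B)) /= lerDl.
  apply: sumr_ge0 => j _; rewrite mulr_ge0 ?exprn_ge0//; last exact: ltW.
  exact: (E_mono j (leq0n _)).
exists b => // w l wr wl.
have [|s [T [_ _ dT sq]]] := hb (fun j => w ^+ j) 1.
  by move=> i; rewrite ncX mul1r lerXn2r// ?nnegrE ?nc_ge0// ltW.
suff -> : l = T by [].
apply: (cvgc_unique wl); rewrite (_ : box_sum _ _ = (fun N =>
    \sum_(m < N) \sum_(i < N) (e m.+1 i - e m i) * w ^+ i)); first exact: sq.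
apply/funext => N; rewrite box_sumE (box_cons _ (pterm c (zjoin x w))) [RHS]exchange_big /=.
apply: eq_bigr => j _.
rewrite -mulr_suml tel; case: N j => [|N] j; first by case: j.
rewrite /e mulr_suml.
by apply: eq_bigr => q _; rewrite -pterm_join.
Qed.

End Slice.

(** The radius [r] does not depend on the point [x] at which the slice is taken. *)
Lemma slice_expands d (f : 'rV[C]_(d + 1) -> C) (a : 'rV[C]_(d + 1)) :
  analytic_at f a -> exists r eta : R, [/\ 0 < r, 0 < eta &
  forall x : 'rV[C]_d, (forall k, nc (x 0 k - zhat a 0 k) < eta) ->
  expands (fun w => f (zjoin x w)) (zlast a) r].
Proof.
move=> [c /near_rVP[eta eta0 h]]; exists (eta / 2), eta; split=> //; first lra.
move=> x xa.
have hz w : nc (w - zlast a) <= eta / 2 ->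
    psum_to c (zjoin (x - zhat a) (w - zlast a)) (f (zjoin x w)).
  move=> wa; have -> : zjoin (x - zhat a) (w - zlast a) = zjoin x w - a.
    rewrite /zjoin -[in RHS](hsubmxK a) opp_row_mx add_row_mx; congr row_mx.
    apply/rowP => i; rewrite (ord1 i) !mxE eqxx !mulr1n /zlast mxE.
    by [].
  apply: h => k; rewrite -(splitK k) /zjoin /zlast /zhat in xa wa *.
  case: (fintype.split k) => i /=.
    by rewrite row_mxEl; have := xa i; rewrite mxE.
  rewrite row_mxEr mxE (ord1 i) eqxx mulr1n; apply: (@le_lt_trans _ _ (eta / 2)); last lra.
  by move: wa; rewrite mxE.
have r0 : 0 < eta / 2 by lra.
have [|ac _] := hz (zlast a + (eta / 2)%:C).
  by rewrite addrAC subrr add0r nc_real gtr0_norm.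
have [M hM] := abs_convergent_bound ac; rewrite addrAC subrr add0r in hM.
have [b bM hb] := slice_power_series r0 hM.
exists b, M; split=> // w wr; apply: hb => //.
by have [_ hw] := hz w wr.
Qed.

(** The terms of positive degree shrink at least linearly when the point approaches
    the center. *)
Lemma analytic_continuous m (f : 'rV[C]_m -> C) (a : 'rV[C]_m) (eps : R) :
  analytic_at f a -> 0 < eps -> exists2 delta : R, 0 < delta &
  forall z : 'rV[C]_m, (forall k, nc (z 0 k - a 0 k) < delta) -> nc (f z - f a) < eps.
Proof.
move=> [c /near_rVP[eta eta0 h]] eps0.
pose rho := eta / 2; have rho0 : 0 < rho by rewrite /rho; lra.
have [|ac _] := h (\row_k (a 0 k + rho%:C)).
  by move=> k; rewrite mxE addrAC subrr add0r nc_real gtr0_norm// /rho; lra.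
have [M hM] := abs_convergent_bound ac.
have M0 : 0 <= M by apply: le_trans (hM 0%N); apply: sumr_ge0 => q _; exact: nc_ge0.
have key (z : 'rV[C]_m) (t : R) : 0 < t -> t <= 1 ->
    (forall k, nc (z 0 k - a 0 k) <= t * rho) -> nc (f z - c [ffun=> 0%N]) <= t * M.
  move=> t0 t1 zt.
  have [|_ zl] := h z.
    move=> k; apply: le_lt_trans (zt k) _; apply: (@le_lt_trans _ _ rho).
      by rewrite ler_piMl// ltW.
    by rewrite /rho; lra.
  apply/ler_addgt0Pr => e e0; have /cvgcP/(_ e e0)[N hN] := zl.
  have := hN N.+1 (leqnSn N); set S := box_sum _ _ _ => SN.
  suff hS : nc (S - c [ffun=> 0%N]) <= t * M.
    have -> : f z - c [ffun=> 0%N] = (S - c [ffun=> 0%N]) - (S - f z) by ring.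
    by apply: le_trans (ncB _ _) _; apply: lerD => //; exact: ltW.
  rewrite /S box_sumE (bigD1 [ffun=> ord0])//=.
  have z0 : box_index [ffun=> @ord0 N] = [ffun=> 0%N] :> {ffun 'I_m -> nat}.
    by apply/ffunP => k; rewrite !ffunE.
  rewrite z0 {1}/pterm big1 => [|k _]; last by rewrite ffunE expr0.
  rewrite mulr1 addrAC subrr add0r; apply: le_trans (nc_sum _ _ _) _.
  apply: (@le_trans _ _ (t * \sum_(q : {ffun 'I_m -> 'I_N.+1} | q != [ffun=> ord0])
      nc (pterm c (\row_k (a 0 k + rho%:C) - a) (box_index q)))); last first.
    apply: ler_wpM2l; first exact: ltW.
    apply: le_trans (hM N.+1); rewrite [leRHS](bigID (fun q => q != [ffun=> ord0])) /= lerDl.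
    by apply: sumr_ge0 => q _; exact: nc_ge0.
  rewrite mulr_sumr; apply: ler_sum => q q0; rewrite !nc_pterm mulrCA.
  apply: ler_wpM2l; first exact: nc_ge0.
  have [k0 qk0] : exists k, (0 < q k)%N.
    apply/existsP; apply: contraNT q0; rewrite negb_exists => /forallP qk.
    apply/eqP/ffunP => k; rewrite ffunE; apply/val_inj/eqP.
    by have := qk k; rewrite lt0n negbK.
  apply: (@le_trans _ _ (\prod_(k < m) (t ^+ q k * rho ^+ q k))).
    apply: ler_prod => k _; rewrite ffunE exprn_ge0 ?nc_ge0//= -exprMn.
    apply: lerXn2r; rewrite ?nnegrE ?nc_ge0//; first by rewrite mulr_ge0// ltW.
    by have := zt k; rewrite !mxE.
  rewrite big_split /=; have -> : \prod_(k < m) nc ((\row_k0 (a 0 k0 + rho%:C) - a) 0 k) ^+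
      box_index q k = \prod_(k < m) rho ^+ q k.
    apply: eq_bigr => k _; rewrite !mxE ffunE addrAC subrr add0r nc_real gtr0_norm//.
  apply: ler_wpM2r; first by apply: prodr_ge0 => k _; rewrite exprn_ge0// ltW.
  rewrite (bigD1 k0)//= -[leRHS]mulr1; apply: ler_pM.
  - by rewrite exprn_ge0// ltW.
  - by apply: prodr_ge0 => k _; rewrite exprn_ge0// ltW.
  - by rewrite -[leRHS]expr1 ler_wiXn2l// ltW.
  apply: prodr_ile1 => k _; apply/andP; split; first by rewrite exprn_ge0// ltW.
  by apply: exprn_ile1 => //; exact: ltW.
have fa : f a = c [ffun=> 0%N].
  apply/eqP; rewrite -subr_eq0 -nc_eq0; apply/eqP/le_anti; rewrite nc_ge0 andbT.
  apply/ler_addgt0Pr => e e0; rewrite add0r.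
  pose t := Num.min 1 (e / (M + 1)).
  have M1 : 0 < M + 1 by lra.
  have t0 : 0 < t by rewrite lt_min ltr01 divr_gt0.
  have te : t <= e / (M + 1) by rewrite ge_min lexx orbT.
  have t1 : t <= 1 by rewrite ge_min lexx.
  apply: le_trans (key a t t0 t1 _) _.
    by move=> k; rewrite subrr nc0 mulr_ge0// ltW.
  rewrite ler_pdivlMr// in te; nra.
pose t := Num.min 1 (eps / (M + 1)).
have M1 : 0 < M + 1 by lra.
have t0 : 0 < t by rewrite lt_min ltr01 divr_gt0.
have te : t <= eps / (M + 1) by rewrite ge_min lexx orbT.
have t1 : t <= 1 by rewrite ge_min lexx.
exists (t * rho); first by rewrite mulr_gt0.
move=> z zt; rewrite fa; apply: le_lt_trans (key z t t0 t1 _) _.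
  by move=> k; exact: ltW.
rewrite ler_pdivlMr// in te; nra.
Qed.

End Slices.

(** * Derivatives of power series, and the Hermite-Genocchi formula *)

Section Derivatives.
Variable R : realType.
Local Notation C := R[i].
Implicit Types (f : C -> C) (c : nat -> C) (v y : C) (r M : R).

(** Two divisions by [- y] write [f] near [y] as a linear function plus a quadratic
    remainder. *)
Lemma derive1_power_series c f v r M y : 0 < r -> coef_bound c r M ->
  (forall y, nc (y - v) <= r -> power_sum c (y - v) (f y)) -> nc (y - v) < r ->
  sums_to (fun m => c m * (m%:R * (y - v) ^+ m.-1)) (derive1 f y).
Proof.
move=> r0 cM cf yr.
have [d1 [f1 [d1M df1 ff1 hd1]]] := deflation r0 yr cM cf.
have [d2 [f2 [d2M df2 ff2 _]]] := deflation r0 yr d1M df1.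
have [|t ht ht'] := hd1 (fun i => (y - v) ^+ i) 1.
  by move=> i; rewrite mul1r ncX lerXn2r// ?nnegrE ?nc_ge0// ltW.
have ty : t = f1 y by apply: sums_to_unique ht _; apply: df1; exact: ltW.
set M2 := M / _ / _ in d2M.
have M20 : 0 <= M2 by exact: coef_bound_ge0 d2M.
suff -> : derive1 f y = t.
  move: ht'; apply: sums_to_ext => m; congr (_ * _).
  under eq_bigr => i _ do rewrite -exprD.
  case: m => [|m]; first by rewrite big_ord0 mul0r.
  rewrite (eq_bigr (fun=> (y - v) ^+ m)) => [|i _]; last first.
    by congr (_ ^+ _); rewrite /= subnK// -ltnS.
  by rewrite sumr_const card_ord mulr_natl.
apply: cvg_lim; first exact: norm_hausdorff.
rewrite ty; apply/cvgrPdist_lt => eps eps0.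
have er : eps = (complex.Re eps)%:C by rewrite RRe_real// ger0_real// ltW.
have e0 : 0 < complex.Re eps by rewrite -ltcR -er.
pose e := complex.Re eps.
apply/near_punctured; exists (Num.min (r - nc (y - v)) (e / (M2 + 1))).
  by rewrite lt_min subr_gt0 yr divr_gt0// ltr_wpDl.
move=> h; rewrite subr0 => /andP[h0]; rewrite lt_min => /andP[hr he].
have hn0 : h != 0 by rewrite -nc_gt0.
have hyr : nc (h + y - v) <= r.
  by rewrite -addrA; apply: le_trans (ncD _ _) _; rewrite -lerBrDr ltW.
rewrite er ltc_nc (ff1 (h + y))// addrK (ff2 (h + y))// addrK.
have -> : f1 y - h^-1 *: (f y + h * (f1 y + h * f2 (h + y)) - f y) = - (h * f2 (h + y)).
  by rewrite /GRing.scale /=; field.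
rewrite ncN ncM.
have f2M : nc (f2 (h + y)) <= M2.
  by have [l /(sums_to_unique (df2 _ hyr)) <-] := power_sum_exists d2M hyr.
apply: (@le_lt_trans _ _ (nc h * M2)); first by apply: ler_wpM2l => //; exact: nc_ge0.
rewrite ltr_pdivlMr ?ltr_wpDl// in he; rewrite -/e; nra.
Qed.

Lemma coef_bound_deriv c r r' M : 0 <= r' -> r' < r -> coef_bound c r M ->
  coef_bound (fun k => k.+1%:R * c k.+1) r' (M / (r - r')).
Proof.
move=> r0 rr cM n; have D0 : 0 < r - r' by rewrite subr_gt0.
rewrite ler_pdivlMr// mulr_suml; apply: le_trans (cM n.+1).
rewrite big_ord_recl /= -[leLHS]add0r; apply: lerD; first by rewrite mulr_ge0 ?nc_ge0.
apply: ler_sum => k _; rewrite ncM nc_nat -/(k.+1) (mulrC k.+1%:R) -!mulrA.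
apply: ler_wpM2l; first exact: nc_ge0.
apply: (@le_trans _ _ ((r - r') * \sum_(i < k.+1) r ^+ (k.+1.-1 - i) * r' ^+ i)); last first.
  by rewrite -subrXX lerBlDr lerDl exprn_ge0.
suff h : k.+1%:R * r' ^+ k <= \sum_(i < k.+1) r ^+ (k.+1.-1 - i) * r' ^+ i.
  by rewrite [leLHS]mulrA [leLHS]mulrC; apply: ler_wpM2l => //; exact: ltW.
rewrite mulr_natl -[k.+1 in X in X <= _]card_ord -sumr_const; apply: ler_sum => i _.
have ik : (i <= k)%N by rewrite -ltnS.
rewrite -[in leLHS](subnK ik) exprD; apply: ler_wpM2r; first by rewrite exprn_ge0.
by apply: lerXn2r; [exact: r0|exact: (le_trans r0 (ltW rr))|exact: ltW].
Qed.

(** Differentiation multiplies the coefficient by the degree, at the price of an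
    arbitrarily small part of the radius; the induction uses midpoints of radii. *)
Lemma derive1n_power_series c f v r M n r' : 0 < r' -> r' < r -> coef_bound c r M ->
  (forall y, nc (y - v) <= r -> power_sum c (y - v) (f y)) ->
  exists2 M', coef_bound (fun k => ((k + n) ^_ n)%:R * c (k + n)%N) r' M' &
  forall y, nc (y - v) <= r' ->
  power_sum (fun k => ((k + n) ^_ n)%:R * c (k + n)%N) (y - v) (derive1n n f y).
Proof.
move=> r'0 rr cM cf; elim: n r' r'0 rr => [|n ih] r' r'0 rr.
  have e : (fun k => ((k + 0) ^_ 0)%:R * c (k + 0)%N) = c.
    by apply/funext => k; rewrite addn0 ffactn0 mul1r.
  exists M; rewrite e; first exact: coef_bound_le (ltW r'0) (ltW rr) cM.
  by move=> y yr; apply: cf; apply: le_trans yr (ltW rr).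
have [||M' cM' cf'] := ih ((r + r') / 2); [lra|lra|].
have e k : k.+1%:R * (((k.+1 + n) ^_ n)%:R * c (k.+1 + n)%N) =
    ((k + n.+1) ^_ n.+1)%:R * c (k + n.+1)%N.
  rewrite mulrA -natrM addSnnS ffactnSr addnS subSn ?leq_addl// addnK mulnC//.
exists (M' / ((r + r') / 2 - r')).
  have := @coef_bound_deriv _ _ r' _ (ltW r'0) _ cM'.
  under eq_fun do rewrite e.
  by apply; lra.
move=> y yr; have [r20 yr'] : 0 < (r + r') / 2 /\ nc (y - v) < (r + r') / 2 by split; lra.
have := sums_to_drop 1 (derive1_power_series r20 cM' cf' yr').
rewrite big_ord1 mul0r mulr0 subr0; apply: sums_to_ext => k.
by rewrite add1n -e; ring.
Qed.

End Derivatives.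

Section MeanPowerSeries.
Variables (R : realType) (n : nat).
Local Notation C := R[i].
Local Notation TR := (measurableTypeR R).
Local Notation T := (n.+1.-tuple TR).
Local Notation P := (@simplex_measure R n).
Local Notation mean := (@complex_integral R _ T P simplex).

Lemma meanZ (c : C) (f : T -> C) : mean_integrable f ->
  mean_integrable (fun a => c * f a) /\ mean (fun a => c * f a) = c * mean f.
Proof.
move=> [f1 f2]; have mS := @measurable_simplex R n.
have cR (x : C) : complex.Re (c * x) = complex.Re c * complex.Re x - complex.Im c * complex.Im x.
  by case: c x => c1 c2 [].
have cI (x : C) : complex.Im (c * x) = complex.Re c * complex.Im x + complex.Im c * complex.Re x.
  by case: c x {cR} => c1 c2 [].
have Z (x : R) g : P.-integrable simplex (EFin \o g) ->
    P.-integrable simplex (EFin \o (fun a => x * g a)).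
  move=> ig; rewrite (_ : _ \o _ = (fun a : T => x%:E * (g a)%:E)%E).
    exact: (integrableZl mS x ig).
  by apply/funext => a; rewrite /= EFinM.
split; first split.
- rewrite (_ : _ \o _ = ((EFin \o (fun a => (complex.Re c * complex.Re (f a))%R)) \-
    (EFin \o (fun a => (complex.Im c * complex.Im (f a))%R)))%E).
    by apply: integrableB => //; exact: Z.
  by apply/funext => a; rewrite /= cR.
- rewrite (_ : _ \o _ = ((EFin \o (fun a => (complex.Re c * complex.Im (f a))%R)) \+
    (EFin \o (fun a => (complex.Im c * complex.Re (f a))%R)))%E).
    by apply: integrableD => //; exact: Z.
  by apply/funext => a; rewrite /= cI.
apply/eqP; rewrite eq_complex cR cI /complex_integral /=.
under eq_Rintegral do rewrite cR.
under [X in _ && (X == _)]eq_Rintegral do rewrite cI.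
by rewrite RintegralB ?RintegralD ?RintegralZl ?eqxx//; exact: Z.
Qed.

(** The Hermite-Genocchi formula for a power series. It holds for each power by
    [mean_pow], also when points coincide, and it passes to the limit by dominated
    convergence, since all convex combinations of the points stay in a smaller
    disk. *)
Lemma mean_derive1n (f : C -> C) (c : nat -> C) (v : C) (r M : R) (x : n.+1.-tuple C) :
  0 < r -> coef_bound c r M ->
  (forall y, nc (y - v) <= r -> power_sum c (y - v) (f y)) ->
  (forall j, nc (tnth x j - v) < r) ->
  exists2 l : C,
   sums_to (fun m => c m * divdiff_pow (thead x - v) [seq b - v | b <- behead x] m) l &
   mean (fun a => derive1n n f (\sum_(j < n.+1) (tnth a j : R)%:C * tnth x j)) = n`!%:R * l.
Proof.
move=> r0 cM cf xr.
pose u : n.+1.-tuple C := [tuple tnth x j - v | j < n.+1].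
(* A radius q < r leaves room for the derivatives to converge normally. *)
have [q [q0 qr xq]] : exists q, [/\ 0 < q, q < r & forall j, nc (tnth x j - v) <= q].
  exists (Num.max (r / 2) (\big[Num.max/0]_(j < n.+1) nc (tnth x j - v))).
  split; first by rewrite lt_max; apply/orP; left; lra.
    rewrite gt_max; apply/andP; split; first lra.
    by apply/bigmax_ltP; split.
  by move=> j; rewrite le_max; apply/orP; right; apply: (le_bigmax _ (fun j => nc (tnth x j - v))).
have [M' cM' cf'] := derive1n_power_series n q0 qr cM cf.
set c' := (fun k => _) in cM' cf'.
pose z (a : T) := \sum_(j < n.+1) (tnth a j : R)%:C * tnth u j.
have zE a : simplex a -> \sum_(j < n.+1) (tnth a j : R)%:C * tnth x j - v = z a.
  move=> [_ a1]; rewrite /z.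
  under [RHS]eq_bigr do rewrite tnth_mktuple mulrBr.
  by rewrite sumrB -mulr_suml -rmorph_sum a1 mul1r.
have zq a : simplex a -> nc (z a) <= q.
  move=> [a0 a1]; apply: le_trans (nc_sum _ _ _) _.
  rewrite -[leRHS]mul1r -a1 mulr_suml; apply: ler_sum => j _.
  by rewrite ncM nc_real ger0_norm// tnth_mktuple; apply: ler_wpM2l.
pose f_ N (a : T) := \sum_(k <- iota 0 N) c' k * z a ^+ k.
have hf N : mean_integrable (f_ N) /\ mean (f_ N) = \sum_(k <- iota 0 N)
    n`!%:R * (c (n + k)%N * divdiff_pow (thead x - v) [seq b - v | b <- behead x] (n + k)).
  apply: mean_sum => k _; have [h1 h2] := mean_pow u k.
  have [h3 h4] := meanZ (c' k) h1.
  split; first exact: h3.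
  rewrite h4 h2.
  have -> : thead u = thead x - v by rewrite /thead tnth_mktuple.
  have -> : behead u = [seq b - v | b <- behead x] :> seq C.
    by rewrite -[in RHS]behead_map; congr behead; rewrite -[in RHS](map_tnth_enum x) -map_comp.
  rewrite /c' (addnC k n).
  (* The falling factorial of the derivative cancels the constant of mean_pow. *)
  have e : ((n + k) ^_ n * k`! = (n + k)`!)%N.
    by rewrite -(@ffact_fact (n + k) n) ?leq_addr// addKn.
  have f0 : ((n + k)`!%:R : C) != 0 by rewrite pnatr_eq0 -lt0n fact_gt0.
  rewrite natrM; have : ((n + k) ^_ n)%:R * k`!%:R = (n + k)`!%:R :> C by rewrite -natrM e.
  move: f0; move: ((n + k)`!%:R : C) ((n + k) ^_ n)%:R (k`!%:R : C) => A B D A0 E.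
  by move: A0; rewrite -E mulf_eq0 negb_or => /andP[B0 D0]; field; rewrite ?B0 ?D0.
have conv : (fun N => mean (f_ N)) @ \oo -->
    mean (fun a => derive1n n f (\sum_(j < n.+1) (tnth a j : R)%:C * tnth x j)).
  apply: (@mean_dominated _ _ _ _ M').
  - by move=> N; have [] := hf N.
  - move=> N a sa; rewrite /f_ (_ : iota 0 N = index_iota 0 N) ?big_mkord; last first.
      by rewrite /index_iota subn0.
    apply: le_trans (nc_sum _ _ _) _.
    apply: le_trans (coef_bound_le (nc_ge0 _) (zq a sa) cM' N).
    by apply: ler_sum => k _; rewrite ncM ncX.
  - move=> a sa; have := cf' (\sum_(j < n.+1) (tnth a j : R)%:C * tnth x j).
    rewrite zE// => /(_ (zq a sa))/sums_toE.
    by rewrite /series /f_; under eq_fun do rewrite /index_iota subn0.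
have [||K hK] := @nc_divdiff_pow R (thead x - v) [seq b - v | b <- behead x] r r0.
- exact: xr.
- move=> _ /mapP[b bx ->]; have /tnthP[j ->] : b \in x by exact: mem_behead.
  exact: xr.
have K0 : 0 <= K by have := le_trans (nc_ge0 _) (hK 0%N); rewrite expr0 mulr1.
pose w m := c m * divdiff_pow (thead x - v) [seq b - v | b <- behead x] m.
have [|l wl _] := @series_abs_cvg R w (M * K).
  move=> N; apply: le_trans (ler_wpM2r K0 (cM N)); rewrite mulr_suml.
  apply: ler_sum => m _; rewrite ncM -mulrA (mulrC _ K).
  by apply: ler_wpM2l; [exact: nc_ge0|exact: hK].
exists l; first by split.
apply: (cvgc_unique conv).
have := sums_toE (sums_toZ n`!%:R (sums_to_drop n (SumsTo wl))).
rewrite big1 ?subr0 => [H|i _].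
  rewrite (_ : (fun N => _) = series (fun k => n`!%:R * w (n + k)%N)); first exact: H.
  by apply/funext => N; have [_ ->] := hf N; rewrite /series /= /index_iota subn0.
rewrite /w; have [h0 _] := divdiff_pow_homogeneous (thead x - v) [seq b - v | b <- behead x].
by rewrite h0 ?mulr0// size_map size_behead size_tuple.
Qed.

End MeanPowerSeries.

(** * The residue sum of the singular part *)

Lemma nc_invB (R : realType) (x y : R[i]) : y != 0 -> nc (x - y) < nc y / 2 ->
  x != 0 /\ nc (x^-1 - y^-1) <= 2 * nc (x - y) / nc y ^+ 2.
Proof.
move=> y0 xy; have Y0 : 0 < nc y by rewrite nc_gt0.
have X0 : nc y / 2 <= nc x.
  have := ncB x (x - y); rewrite opprB addrC subrK; lra.
have x0 : x != 0 by rewrite -nc_gt0; lra.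
split=> //; have -> : x^-1 - y^-1 = - ((x - y) * (x^-1 * y^-1)) by field; rewrite x0 y0.
rewrite ncN !ncM !ncV (mulrC 2) -!mulrA; apply: ler_wpM2l; first exact: nc_ge0.
have XI : (nc x)^-1 <= 2 / nc y.
  by rewrite -lef_pV2 ?posrE ?invf_div ?invrK ?divr_gt0 ?invr_gt0 //; lra.
rewrite expr2 invfM mulrA; apply: ler_wpM2r => //.
by rewrite invr_ge0 nc_ge0.
Qed.

Section Assembly.
Variables (R : realType) (d n : nat).
Local Notation C := R[i].

Lemma uniform_continuity_at (v : 'I_n.+1 -> 'rV[C]_d -> C) (a : 'rV[C]_d) (e : R) :
  (forall j, analytic_at (v j) a) -> 0 < e ->
  exists2 delta : R, 0 < delta & forall z : 'rV[C]_d,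
    (forall k, nc (z 0 k - a 0 k) < delta) -> forall j, nc (v j z - v j a) < e.
Proof.
move=> va e0; have /choice[dl hdl] : forall j, exists dl : R, 0 < dl /\
    forall z : 'rV[C]_d, (forall k, nc (z 0 k - a 0 k) < dl) -> nc (v j z - v j a) < e.
  by move=> j; have [dl d0 h] := analytic_continuous (va j) e0; exists dl.
exists (\big[Num.min/1]_(j < n.+1) dl j).
  by apply/bigmin_gtP; split=> // j _; have [] := hdl j.
move=> z hz j; have [_ h] := hdl j; apply: h => k; apply: lt_le_trans (hz k) _.
exact: bigmin_le.
Qed.

(** The change of variable [y = w^-1] for the integrand of the residues. *)
Lemma slice_polar (F phi : 'rV[C]_(d + 1) -> C) (v : 'I_n.+1 -> 'rV[C]_d -> C) s zh (w : C) :
  w != 0 -> F (zjoin zh w) = phi (zjoin zh w) / \prod_(j < n.+1) (1 - w * v j zh) ->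
  hfun n phi s zh w^-1 * polar [tuple v j zh | j < n.+1] w = slice F s zh w.
Proof.
move=> w0 Fw; rewrite /slice Fw /hfun invrK /polar big_tuple.
have -> : \prod_(j < n.+1) (1 - w * v j zh) =
    w ^+ n.+1 * \prod_(j < n.+1) (w^-1 - tnth [tuple v j zh | j < n.+1] j).
  have -> : w ^+ n.+1 = \prod_(j < n.+1) w by rewrite prodr_const card_ord.
  rewrite -big_split; apply: eq_bigr => j _.
  by rewrite /= tnth_mktuple mulrBr mulfV.
rewrite invfM; set Q := (\prod_(j < n.+1) _)^-1; set p := phi _.
rewrite !exprVn; have -> : w ^+ n.+1 = w ^+ n * w by rewrite exprSr.
have -> : w ^+ (s + n) = w ^+ s * w ^+ n by rewrite exprD.
have -> : w ^+ s.+1 = w ^+ s * w by rewrite exprSr.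
by move: (expf_neq0 s w0) (expf_neq0 n w0) => A B; field; rewrite A B w0.
Qed.

End Assembly.

Unset Implicit Arguments.
Set Strict Implicit.
Set Printing Implicit Defensive.

Theorem corollary4p3 (R : realType) (d n : nat)
  (rho : 'I_(d + 1) -> R) (F G H : 'rV[R[i]]_(d + 1) -> R[i])
  (a : {ffun 'I_(d + 1) -> nat} -> R[i])
  (zs : 'rV[R[i]]_(d + 1))
  (v : 'I_n.+1 -> 'rV[R[i]]_d -> R[i]) (phi : 'rV[R[i]]_(d + 1) -> R[i])
  (rho_gt0 : forall k, 0 < rho k)
  (G_analytic : forall z, polydisk rho z -> analytic_at G z)
  (H_analytic : forall z, polydisk rho z -> analytic_at H z)
  (F_quotient : is_quotient F G H rho)
  (F_series : \forall z \near (0 : 'rV[R[i]]_(d + 1)), psum_to a z (F z))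
  (zs_minimal : strictly_minimal (variety H rho) a zs)
  (zs_multiple : multiple_point F (variety H rho) v phi zs) :
  exists2 eps0 : R, 0 < eps0 &
    forall eps : R, 0 < eps < eps0 ->
      exists2 delta : R, 0 < delta &
        forall zh : 'rV[R[i]]_d, `|zh - zhat zs| < delta%:C ->
        forall s : nat,
          residue_sum (slice F s zh) (zlast zs) eps =
          - (n`!%:R)^-1 *
            complex_integral (@simplex_measure R n) simplex
              (fun alpha => derive1n n (hfun n phi s zh)
                 (\sum_(j < n.+1) (tnth alpha j)%:C * v j zh)).
Proof.
have [[v_an phi_an] F_eq v_eq _ V_eq] := zs_multiple.
set p := zlast zs in v_eq *; pose y0 := p^-1.
have p0 : p != 0.
  by apply/eqP => p0; have := v_eq ord0; rewrite p0 mul0r => /eqP; rewrite eq_sym oner_eq0.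
have y00 : y0 != 0 by rewrite invr_eq0.
have vy0 j : v j (zhat zs) = y0 by apply: (mulfI p0); rewrite v_eq mulfV.
have P0 : 0 < nc p by rewrite nc_gt0.
have Y0 : 0 < nc y0 by rewrite nc_gt0.
have [r [eta [r0 eta0 phi_slice]]] := slice_expands phi_an.
have [e1 e10 nearF] := near_rVP F_eq.
have [e2 e20 nearV] := near_rVP V_eq.
have [|tau t0 [inv_r inv]] := @inversion_expansion R p r y0 y00.
  by rewrite invrK subrr nc0.
have m0 : 0 < Num.min e1 e2 by rewrite lt_min e10.
(* The disk of this radius avoids 0, and its inverse lies in the disk about y0 on
   which h is a power series. *)
exists (Num.min (Num.min e1 e2) (Num.min (nc p / 2) (tau * nc p ^+ 2 / 2))).
  by rewrite !lt_min e10 e20 divr_gt0// divr_gt0 ?mulr_gt0 ?exprn_gt0.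
move=> eps /andP[eps0]; rewrite !lt_min => /andP[/andP[eps1 eps2] /andP[epsp epst]].
have D0 : ~ nc (0 - p) < eps by rewrite sub0r ncN; lra.
have Dy0 w : nc (w - p) < eps -> nc (w^-1 - y0) < tau.
  move=> we; have [|_ h] := @nc_invB _ w p p0; first exact: lt_trans epsp.
  apply: le_lt_trans h _; rewrite ltr_pdivrMr ?exprn_gt0//; lra.
(* If v_j is this close to y0, then its inverse is a pole inside the disk of
   radius eps about p. *)
pose k0 := Num.min (nc y0 / 2) (eps * nc y0 ^+ 2 / 2).
have k00 : 0 < k0 by rewrite lt_min !divr_gt0// mulr_gt0 ?exprn_gt0.
have Dinv y : nc (y - y0) < k0 -> nc (y^-1 - p) < eps.
  rewrite lt_min => /andP[y1 y2]; have [_] := nc_invB y00 y1.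
  rewrite /y0 invrK -/y0 => h; apply: le_lt_trans h _.
  rewrite ltr_pdivrMr ?exprn_gt0//; lra.
have [dl dl0 hdl] := uniform_continuity_at v_an k00.
exists (Num.min dl (Num.min eta (Num.min e1 e2))); first by rewrite !lt_min dl0 eta0 e10.
have dm0 : 0 < Num.min dl (Num.min eta (Num.min e1 e2)) by rewrite !lt_min dl0 eta0 e10.
move=> zh /(rV_ballP _ _ dm0) hzh s.
have hz k : [/\ nc (zh 0 k - zhat zs 0 k) < dl, nc (zh 0 k - zhat zs 0 k) < eta,
    nc (zh 0 k - zhat zs 0 k) < e1 & nc (zh 0 k - zhat zs 0 k) < e2].
  by have := hzh k; rewrite !lt_min => /and4P[].
pose x := [tuple v j zh | j < n.+1].
have xD j : nc (tnth x j - y0) < k0.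
  by rewrite tnth_mktuple -(vy0 j); apply: hdl => k; have [] := hz k.
have [c [M [cM ch]]] : expands (hfun n phi s zh) y0 tau.
  have phi_inv : expands (fun y => phi (zjoin zh y^-1)) y0 tau.
    have [|b [B [bB bphi]]] := phi_slice zh; first by move=> k; have [] := hz k.
    have [c cB hc] := inv b B bB; exists c, B; split=> // y yt.
    by apply: hc => //; apply: bphi; exact: inv_r.
  by apply: expandsM => //; apply: expandsX => //; apply: expands_id; exact: ltW.
have k0t : k0 <= tau.
  apply: le_trans (_ : eps * nc y0 ^+ 2 / 2 <= tau); first by rewrite ge_min lexx orbT.
  rewrite /y0 ncV exprVn ler_pdivrMr// ler_pdivrMr ?exprn_gt0//; lra.
have [l lsum lmean] := mean_derive1n t0 cM ch (fun j => lt_le_trans (xD j) k0t).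
have lmean' : complex_integral (@simplex_measure R n) simplex
    (fun alpha => derive1n n (hfun n phi s zh)
      (\sum_(j < n.+1) (tnth alpha j)%:C * v j zh)) = n`!%:R * l.
  rewrite -lmean; congr complex_integral; apply/funext => alpha; congr (derive1n _ _ _).
  by apply: eq_bigr => j _; rewrite tnth_mktuple.
have nf0 : (n`!%:R : R[i]) != 0 by rewrite pnatr_eq0 -lt0n fact_gt0.
rewrite lmean' mulNr mulKf//; apply: has_residue_sumE.
have xE : thead x :: behead x = x :> seq R[i] by rewrite [in RHS](tuple_eta x).
have xP b : b \in thead x :: behead x -> nc (b^-1 - p) < eps.
  by rewrite xE => /tnthP[j ->]; exact: Dinv.
have := has_residue_sum_divdiff D0 t0 cM ch Dy0 xP lsum.
rewrite xE; apply: (@has_residue_sum_ext _ _ _ [seq b^-1 | b <- x]) => w wD wx.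
have w0 : w != 0 by exact: (D_neq0 D0 wD).
have near_w (e : R) : eps < e -> (forall k, nc (zh 0 k - zhat zs 0 k) < e) ->
    forall k, nc (zjoin zh w 0 k - zs 0 k) < e.
  move=> eps_e hk k; rewrite -(splitK k); case: (fintype.split k) => i /=.
    by rewrite row_mxEl; have := hk i; rewrite mxE.
  rewrite row_mxEr mxE (ord1 i) eqxx mulr1n; apply: lt_trans eps_e.
  by move: wD; rewrite /p /zlast /= mxE.
have zl : zlast (zjoin zh w) = w by rewrite /zlast /zjoin row_mxKr mxE eqxx mulr1n.
have zht : zhat (zjoin zh w) = zh by rewrite /zhat /zjoin row_mxKl.
apply: slice_polar => //.
have := nearF (zjoin zh w) (near_w _ eps1 (fun k => let: And4 _ _ h _ := hz k in h)).
rewrite zl zht; apply => Vw.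
have [j] := (nearV (zjoin zh w) (near_w _ eps2 (fun k => let: And4 _ _ _ h := hz k in h))).2 Vw.
rewrite zl zht => wv; move: wx => /mapP; apply; exists (v j zh).
  by apply/tnthP; exists j; rewrite tnth_mktuple.
have v0 : v j zh != 0.
  by apply/eqP => v0; move: wv => /eqP; rewrite v0 mulr0 eq_sym oner_eq0.
by apply: (mulIf v0); rewrite wv mulVf.
Qed.
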